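(* Let $m, l_1,\ldots,l_m \in \mathbb{N}$ with $l_1\le \cdots \le l_m$, and $l_2\ge 2$ if $m \ge 2$. Let $G=\Theta(l_1,\ldots,l_m)$. Then the total graph $T(G)$ is equitably $k$-choosable for every $k \geq m+2$.
   Context: All graphs are finite and simple. $\Theta(l_1,\ldots,l_m)$ denotes the graph consisting of two vertices $u,w$ joined by $m$ internally disjoint paths of lengths $l_1,\ldots,l_m$. The total graph $T(G)$ of a graph $G$ has vertex set $V(G)\cup E(G)$, two elements being adjacent in $T(G)$ iff they are adjacent or incident in $G$. A $k$-assignment $L$ for a graph $G$ assigns to each vertex $v$ a set $L(v)$ of exactly $k$ colors. An equitable $L$-coloring of $G$ is a proper coloring $f$ of $G$ with $f(v)\in L(v)$ for all $v$, such that no color is used on more than $\lceil |V(G)|/k\rceil$ vertices. $G$ is equitably $k$-choosable if it has an equitable $L$-coloring for every $k$-assignment $L$. *)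

(* Defs.v *)
From mathcomp Require Import all_boot.
Set Implicit Arguments. Unset Strict Implicit. Unset Printing Implicit Defensive.

(* Vertices: inl true = u, inl false = w, and inr (existT i j) with j : 'I_(l i).-1
   is the (j+1)-th internal vertex of the i-th path (positions 1 .. l i - 1). *)
Definition theta_vertex (m : nat) (l : 'I_m -> nat) : finType :=
  (bool + {i : 'I_m & 'I_(l i).-1})%type.

Definition theta_pos (m : nat) (l : 'I_m -> nat) (i : 'I_m)
    (v : theta_vertex l) : option nat :=
  match v with
  | inl true => Some 0
  | inl false => Some (l i)
  | inr (existT i' j) => if i' == i then Some (nat_of_ord j).+1 else None
  end.

Definition theta_adj (m : nat) (l : 'I_m -> nat) : rel (theta_vertex l) :=
  fun x y => [exists i : 'I_m,
    match theta_pos i x, theta_pos i y with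
    | Some a, Some b => (a.+1 == b) || (b.+1 == a)
    | _, _ => false
    end].

Definition is_edge (V : finType) (e : rel V) (A : {set V}) : bool :=
  [exists x, exists y, e x y && (A == [set x; y])].

Definition edge_type (V : finType) (e : rel V) : finType :=
  {A : {set V} | is_edge e A}.

Definition total_vertex (V : finType) (e : rel V) : finType :=
  (V + edge_type e)%type.

Definition total_adj (V : finType) (e : rel V) : rel (total_vertex e) :=
  fun a b =>
    match a, b with
    | inl x, inl y => e x y
    | inl x, inr B => x \in val B
    | inr A, inl y => y \in val A
    | inr A, inr B => (A != B) && (val A :&: val B != set0)
    end.

Definition ceil_div (n k : nat) : nat := (n + k.-1) %/ k.

Definition k_assignment (T : finType) (k : nat) (L : T -> seq nat) : Prop :=
  forall v, uniq (L v) /\ size (L v) = k.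

Definition equitable_L_coloring (T : finType) (r : rel T) (k : nat)
    (L : T -> seq nat) (f : T -> nat) : Prop :=
  [/\ forall v, f v \in L v,
      forall x y, r x y -> f x != f y &
      forall c : nat, #|[pred v | f v == c]| <= ceil_div #|T| k].

Definition equitably_choosable (T : finType) (r : rel T) (k : nat) : Prop :=
  forall L : T -> seq nat, k_assignment k L ->
    exists f : T -> nat, equitable_L_coloring r k L f.

(* Main.v *)
Require Import Defs.
From mathcomp Require Import all_boot zify.
Set Implicit Arguments. Unset Strict Implicit. Unset Printing Implicit Defensive.

(* T(G) is the square of the graph obtained from G by subdividing every edge once,
   so its vertices lie on m paths with s_i = 2 l_i - 1 inner vertices each between
   the ends u and w. The n vertices are coloured in ceil(n / k) blocks of at most k
   vertices, each block using pairwise distinct colours. A block S can be added to a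
   coloured set A as soon as, for every t <= k, at most k - t vertices of S have t or
   more neighbours in A: colour the vertices of S greedily by decreasing number of
   neighbours in A. It remains to order the vertices so that all blocks meet this
   condition. If some l_i >= 3, each path is listed downwards from w, so that a block
   contains three consecutive vertices of a path, which have few neighbours before it,
   and u comes last. If l_i = 2 for all i (except possibly l_1 = 1), two or three
   explicit blocks are enough. Two cases need orders or colours that depend on the
   lists: the square of an even cycle (m = 2) with k = 4, and Theta(1, 2, 2, 2) with
   k = 6. *)

(** * Colouring block by block *)

(** Each colour occurs at most once per block, which is why ceil(n / k) blocks make the colouring
    equitable. That number leaves little room: most blocks have exactly k vertices, so t = 1 and t =
    2 demand a vertex with no coloured neighbour and a second one with at most one. The ends are the
    obstacle: u and w have 2m neighbours each, and the first vertices of the m paths are pairwise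
    adjacent, while k may be only m + 2. A vertex of such degree can be afforded only if most of its
    neighbours come later or share its block; hence w opens the order together with some of its
    neighbours, and u closes it together with some of its own. The two exceptions are cases in which
    a full last block misses a bound by one. In the even cycle with k = 4 its vertices have 2, 1, 1,
    2 coloured neighbours, so none is free; for Theta(1, 2, 2, 2) with k = 6 the second block used
    below has 4, 4, 3, 3, 2, 0, so four vertices reach t = 3, where three are allowed. *)

Section Blocks.
Variables (T : finType) (r : rel T) (L : T -> seq nat) (k : nat).

Lemma greedy_representatives (S : {set T}) (P : T -> seq nat) (o : T -> nat) :
  (forall x, x \in S -> uniq (P x)) ->
  (forall x, x \in S -> k <= size (P x) + o x) ->
  (forall t, t <= k -> #|[set x in S | t <= o x]| <= k - t) ->
  exists2 g : T -> nat, (forall x, x \in S -> g x \in P x) & {in S &, injective g}.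
Proof.
elim: {S}_.+1 {-2}S (ltnSn #|S|) => // n IHn S leSn Pu Psz cnt.
have [S0|[x0 x0S]] := set_0Vmem S.
  by exists (fun=> 0) => x; rewrite S0 inE.
have cardS : #|S| <= k.
  have := cnt 0 (leq0n _); rewrite subn0; apply: leq_trans.
  by apply/subset_leq_card/subsetP => x xS; rewrite inE xS.
have Spos : 0 < #|S| by apply/card_gt0P; exists x0.
(* This [x] is coloured last. If there were none, all of [S] would have [o x > k - #|S|], while
   [cnt] at [t = k - #|S| + 1] allows only [#|S| - 1] such vertices. *)
have [x xS ox] : exists2 x, x \in S & o x + #|S| <= k.
  apply/exists_inP; apply: contraT; rewrite negb_exists_in => /forall_inP H.
  have := cnt (k - #|S|).+1 ltac:(lia).
  suff -> : [set x in S | (k - #|S|).+1 <= o x] = S.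
    by move: cardS Spos; set a := #|S|; lia.
  by apply/setP=> x; rewrite !inE; case xS: (x \in S) => //=; move: (H x xS); lia.
have xcard : #|S| = #|S :\ x|.+1 by rewrite (cardsD1 x S) xS.
have [||||g gP ginj] := IHn (S :\ x).
- by move: leSn; rewrite xcard ltnS.
- by move=> y; rewrite !inE => /andP[_]; apply: Pu.
- by move=> y; rewrite !inE => /andP[_]; apply: Psz.
- move=> t tk; apply: leq_trans (cnt t tk); apply/subset_leq_card/subsetP => y.
  by rewrite !inE -andbA => /and3P[_ -> ->].
have [c cP cg] : exists2 c, c \in P x & c \notin [seq g y | y <- enum (S :\ x)].
  apply/hasP; apply: contraT => /hasPn H.
  have sz : size (P x) <= #|S :\ x|.
    rewrite cardE -(size_map g); apply: (uniq_leq_size (Pu x xS)) => c cP.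
    by move: (H c cP); rewrite /= negbK.
  by have := Psz x xS; move: ox sz; rewrite xcard; set a := #|S :\ x|; lia.
have gc y : y \in S -> y != x -> g y != c.
  move=> yS yx; apply: contra cg => /eqP <-; apply: map_f.
  by rewrite mem_enum !inE yx.
exists (fun y => if y == x then c else g y).
  by move=> y yS; case: eqP => [->//|/eqP yx]; apply: gP; rewrite !inE yx.
move=> y z yS zS /=; case: eqP => [->|/eqP yx]; case: eqP => [->//|/eqP zx] E.
- by have := gc z zS zx; rewrite E eqxx.
- by have := gc y yS yx; rewrite E eqxx.
- by apply: ginj; rewrite // !inE ?yx ?zx.
Qed.

Hypothesis r_sym : symmetric r.
Hypothesis L_uniq : forall v, uniq (L v).
Hypothesis L_size : forall v, size (L v) = k.

Definition partial_coloring (f : T -> nat) (A : {set T}) (q : nat) :=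
  [/\ {in A, forall v, f v \in L v},
      {in A &, forall x y, r x y -> f x != f y} &
      forall c, #|[set v in A | f v == c]| <= q].

Definition available f (A : {set T}) x :=
  [seq c <- L x | c \notin [seq f y | y <- enum [set y in A | r x y]]].

Lemma available_uniq f A x : uniq (available f A x).
Proof. exact: filter_uniq. Qed.

(** Only neighbours whose colour lies in [L x] cost a colour; [cycle_distinct] and
    [available_deg_rem] exploit this refinement. *)
Lemma available_size f A x :
  k <= size (available f A x) + #|[set y in A | r x y & f y \in L x]|.
Proof.
rewrite -(L_size x) size_filter; set a := (X in count X _).
rewrite -(count_predC a (L x)) leq_add2l -size_filter cardE -(size_map f).
apply: uniq_leq_size; first exact: filter_uniq.
move=> c; rewrite mem_filter /= negbK => /andP[/mapP[y]].
rewrite mem_enum !inE => /andP[yA rxy] -> fyL.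
by apply: map_f; rewrite mem_enum !inE yA rxy fyL.
Qed.

Lemma available_notin f A x y c :
  c \in available f A x -> y \in A -> r x y -> f y != c.
Proof.
rewrite mem_filter => /andP[cN _] yA rxy; apply: contra cN => /eqP <-.
by apply: map_f; rewrite mem_enum !inE yA.
Qed.

Lemma glue_block f A (S : {set T}) q g :
  partial_coloring f A q -> [disjoint A & S] ->
  (forall x, x \in S -> g x \in available f A x) -> {in S &, injective g} ->
  (forall x, ~~ r x x) ->
  partial_coloring (fun x => if x \in A then f x else g x) (A :|: S) q.+1.
Proof.
move=> [fL fr fc] dAS gP ginj r_irr.
have SnA x : x \in S -> x \in A = false.
  by move=> xS; apply/negbTE; move: dAS; rewrite disjoint_sym => /disjointFr->.
split.
- move=> v; rewrite inE; case vA: (v \in A) => /= vS; first exact: fL.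
  by have := gP v vS; rewrite mem_filter => /andP[].
- move=> x y; rewrite !inE.
  case xA: (x \in A); case yA: (y \in A) => /= xS yS rxy.
  + exact: fr.
  + by apply: (available_notin (gP y yS) xA); rewrite r_sym.
  + by rewrite eq_sym; apply: (available_notin (gP x xS) yA).
  + by apply: contraTneq rxy => /(ginj _ _ xS yS) ->.
- move=> c; have sub : [set v in A :|: S | (if v \in A then f v else g v) == c]
    \subset [set v in A | f v == c] :|: [set v in S | g v == c].
    apply/subsetP=> v; rewrite !inE.
    by case: (v \in A) => /= [->//|/andP[-> ->]].
  apply: leq_trans (subset_leq_card sub) _.
  apply: leq_trans (leq_card_setU _ _) _; rewrite -addn1; apply: leq_add => //.
  apply/card_le1_eqP => x y; rewrite !inE => /andP[xS /eqP gx] /andP[yS /eqP gy].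
  by apply: ginj; rewrite // gx gy.
Qed.

(** The survival of the old colours is recorded for [cycle_prefix], where a colour is prescribed in
    the first block. *)
Lemma extend_block f (A S : {set T}) q :
  (forall x, ~~ r x x) -> partial_coloring f A q -> [disjoint A & S] ->
  (forall t, t <= k ->
     #|[set x in S | t <= #|[set y in A | r x y & f y \in L x]|]| <= k - t) ->
  exists2 f', partial_coloring f' (A :|: S) q.+1 & {in A, f' =1 f}.
Proof.
move=> r_irr fA dAS cnt.
have [||g gP ginj] := greedy_representatives (P := available f A) _ _ cnt.
- by move=> x _; apply: available_uniq.
- by move=> x _; apply: available_size.
- exists (fun x => if x \in A then f x else g x); first exact: glue_block.
  by move=> x /= ->.
Qed.

End Blocks.

(** * Blocks as lists of codes *)

Section BlockLists.
Variables (C : eqType) (adj : rel C).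

(* [adj] may have loops; [deg] ignores them. *)
Definition deg (c : C) (A : seq C) := size (undup [seq y <- A | adj c y && (y != c)]).

Lemma deg_le c A B :
  (forall y, y \in A -> adj c y -> y != c -> y \in B) -> deg c A <= size B.
Proof.
move=> H; apply: uniq_leq_size; first exact: undup_uniq.
by move=> y; rewrite mem_undup mem_filter => /andP[/andP[? ?] ?]; apply: H.
Qed.

Definition admissible k (A S : seq C) :=
  forall t, t <= k -> count (fun c => t <= deg c A) S <= k - t.

Variables (T : finType) (r : rel T) (L : T -> seq nat) (k : nat) (code : T -> C).
Hypotheses (r_sym : symmetric r) (r_irr : forall x, ~~ r x x).
Hypotheses (L_uniq : forall v, uniq (L v)) (L_size : forall v, size (L v) = k).
Hypotheses (code_inj : injective code).
Hypothesis (code_adj : forall x y, r x y -> adj (code x) (code y)).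

Definition coded (A : seq C) := [set x | code x \in A].

Definition colorable (A : seq C) q := exists f, partial_coloring r L f (coded A) q.

Lemma card_coded A : #|coded A| <= size A.
Proof.
rewrite cardE -(size_map code); apply: uniq_leq_size.
  by rewrite map_inj_uniq ?enum_uniq.
by move=> c /mapP[x]; rewrite mem_enum inE => ? ->.
Qed.

(** [A] and [S] may overlap: only the part of [S] outside [A] is new. The explicit lists for short
    paths therefore need only be shown to cover all codes. *)
Lemma coded_cat (A S : seq C) :
  coded (A ++ S) = coded A :|: [set x | (code x \in S) && (code x \notin A)].
Proof.
by apply/setP=> x; rewrite !inE mem_cat; case: (code x \in A); rewrite ?andbT.
Qed.

Lemma coded_disjoint (A S : seq C) :
  [disjoint coded A & [set x | (code x \in S) && (code x \notin A)]].
Proof.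
by apply/pred0P=> x /=; rewrite !inE; case: (code x \in A); rewrite ?andbF.
Qed.

Lemma card_nbrs (A : seq C) x : code x \notin A ->
  #|[set y in coded A | r x y]| <= deg (code x) A.
Proof.
move=> xA; rewrite cardE -(size_map code); apply: uniq_leq_size.
  by rewrite map_inj_uniq ?enum_uniq.
move=> c /mapP[y]; rewrite mem_enum !inE => /andP[yA rxy] ->.
rewrite mem_undup mem_filter yA andbT code_adj //=.
by apply: contraNneq xA => <-.
Qed.

Lemma card_filter_coded (P : pred C) (S : seq C) :
  #|[set x | (code x \in S) && P (code x)]| <= count P S.
Proof.
rewrite -size_filter cardE -(size_map code); apply: uniq_leq_size.
  by rewrite map_inj_uniq ?enum_uniq.
move=> c /mapP[x]; rewrite mem_enum !inE => /andP[xS xP] ->.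
by rewrite mem_filter xP.
Qed.

Lemma extend_coded f A S q :
  partial_coloring r L f (coded A) q -> admissible k A S ->
  exists2 f', partial_coloring r L f' (coded (A ++ S)) q.+1 & {in coded A, f' =1 f}.
Proof.
move=> fA adm; rewrite coded_cat.
apply: (extend_block r_sym L_uniq L_size r_irr fA (coded_disjoint A S)) => t tk.
apply: leq_trans (adm t tk); apply: leq_trans (card_filter_coded _ _).
apply/subset_leq_card/subsetP=> x; rewrite !inE => /andP[/andP[-> xA]] /= le_t.
apply: leq_trans le_t (leq_trans _ (card_nbrs xA)).
by apply/subset_leq_card/subsetP=> y; rewrite !inE => /and3P[-> ->].
Qed.

Lemma colorable_cat A S q :
  colorable A q -> admissible k A S -> colorable (A ++ S) q.+1.
Proof. by move=> [f fA] /(extend_coded fA)[f' f'P _]; exists f'. Qed.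

Lemma colorable_nil q : colorable [::] q.
Proof.
exists (fun=> 0); split => [v|v|c]; rewrite ?inE //.
by rewrite (_ : [set v in coded [::] | _] = set0) ?cards0 //; apply/setP=> x; rewrite !inE.
Qed.

Lemma colorable_small A q : size A <= k -> colorable A q.+1.
Proof.
move=> Ak; rewrite -[A]cat0s; apply: colorable_cat; first exact: colorable_nil.
move=> [|t] tk; first by rewrite subn0 (leq_trans (count_size _ _)).
by rewrite (@eq_count _ _ pred0) ?count_pred0.
Qed.

Lemma colorable_total A q : (forall x, code x \in A) -> colorable A q ->
  exists f, [/\ forall v, f v \in L v, forall x y, r x y -> f x != f y &
                forall c, #|[pred v | f v == c]| <= q].
Proof.
move=> inA [f [f1 f2 f3]]; exists f; split=> [v|x y|c].
- by apply: f1; rewrite inE.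
- by apply: f2; rewrite inE.
- by apply: leq_trans (f3 c); apply/subset_leq_card/subsetP=> x; rewrite !inE inA.
Qed.

End BlockLists.

(** * Sufficient conditions for an admissible block *)

Section Criteria.
Variables (C : eqType) (adj : rel C) (k : nat).
Implicit Types (A B S : seq C).

Lemma deg_eq0 c A : (forall y, y \in A -> adj c y -> y = c) -> deg adj c A = 0.
Proof.
move=> H; apply/eqP; rewrite -leqn0; apply: (deg_le (B := [::])) => y yA cy.
by rewrite (H y yA cy) eqxx.
Qed.

Fixpoint deg_bounded A (gs : seq (nat * seq C)) : Prop :=
  if gs is g :: gs' then
    (forall c, c \in g.2 -> deg adj c A <= g.1) /\ deg_bounded A gs'
  else True.

(** A group whose degree bound is at least [t] is counted in full, the others not at all. This turns
    admissibility into arithmetic on group sizes. *)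
Lemma admissible_groups A (gs : seq (nat * seq C)) : deg_bounded A gs ->
  (forall t, t <= k -> sumn [seq (if t <= g.1 then size g.2 else 0) | g <- gs] <= k - t) ->
  admissible adj k A (flatten [seq g.2 | g <- gs]).
Proof.
move=> Hd Ht t tk; apply: leq_trans (Ht t tk); rewrite count_flatten -map_comp {Ht}.
elim: gs Hd => //= g gs IH [Hg /IH {}IH]; apply: leq_add => //.
case: (leqP t g.1) => [_|lt_t]; first exact: count_size.
rewrite (@eq_in_count _ _ pred0) ?count_pred0 // => c cg.
by apply/negbTE; rewrite -ltnNge; apply: leq_ltn_trans lt_t; apply: Hg.
Qed.

Lemma count_uniq_le (P : pred C) S B :
  uniq S -> {in S, forall c, P c -> c \in B} -> count P S <= size B.
Proof.
move=> uS SB; rewrite -size_filter; apply: uniq_leq_size; first exact: filter_uniq.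
by move=> c; rewrite mem_filter => /andP[Pc cS]; apply: SB.
Qed.

(** A block of [k] vertices must contain one that loses no colour and another that loses at most
    one; these witnesses settle [t = 1] and [t = 2]. *)
Lemma count_low A S c0 c1 : uniq S -> c0 \in S -> c1 \in S -> c0 != c1 ->
  deg adj c0 A = 0 -> deg adj c1 A <= 1 ->
  count (fun c => 1 <= deg adj c A) S <= (size S).-1 /\
  count (fun c => 2 <= deg adj c A) S <= (size S).-2.
Proof.
move=> uS c0S c1S c01 d0 d1.
have /permP E0 := perm_to_rem c0S.
have c1S' : c1 \in rem c0 S by rewrite mem_rem_uniq // !inE eq_sym c01.
have /permP E1 := perm_to_rem c1S'.
have s0 := size_rem c0S; have s1 := size_rem c1S'.
split; first by rewrite E0 /= d0 add0n -s0 count_size.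
rewrite E0 /= E1 /= d0 /= (_ : 2 <= _ = false) ?add0n; last by lia.
by apply: leq_trans (count_size _ _) _; rewrite s1 s0.
Qed.

(* Applied to blocks with three consecutive vertices of a path, whose first two are
   [c0] and [c1]; [B] collects the exceptional vertices of large degree. *)
Lemma admissible_low A S B : uniq S -> size S <= k -> size B <= 2 ->
  {in S, forall c, deg adj c A <= (if c \in B then k - 2 else 2)} ->
  size S <= k - 2 \/
  (exists c0 c1, [/\ c0 \in S, c1 \in S, c0 != c1, deg adj c0 A = 0 & deg adj c1 A <= 1]) ->
  admissible adj k A S.
Proof.
move=> uS Sk B2 low zero t tk.
(* From [t = 3] on only the at most two members of [B] can count, and only up to [t = k - 2], where
   two vertices are still allowed. *)
have [t2|t3] := leqP t 2; last first.
  have [tk'|tk'] := leqP t (k - 2).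
    apply: leq_trans (_ : size B <= _); last by lia.
    apply: count_uniq_le => // c cS; move: (low c cS); case: (c \in B) => //=; lia.
  rewrite (@eq_in_count _ _ pred0) ?count_pred0 // => c cS.
  by move: (low c cS); case: ifP => _ /=; lia.
have [Ssmall|[c0 [c1 [c0S c1S c01 d0 d1]]]] := zero.
  by apply: leq_trans (count_size _ _) _; lia.
have [H1 H2] := count_low uS c0S c1S c01 d0 d1.
move: t2 tk; case: t => [|[|[|//]]] _ tk; first by rewrite subn0 (leq_trans (count_size _ _)).
- by lia.
- by lia.
Qed.

End Criteria.

(** * The square of the subdivided theta graph *)

Notation node := (nat * nat)%type.

Section Model.
Variables (m : nat) (s : nat -> nat).

(* [(i, p)] with [i < m] and [1 <= p <= s i] is the [p]-th inner vertex of the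
   square of the [i]-th path; [(m, 0)] and [(m, 1)] are its common ends. *)
Definition pos (i p : nat) : node :=
  if p == 0 then (m, 0) else if p <= s i then (i, p) else (m, 1).

Definition path_nbrs (i p : nat) : seq node :=
  [:: pos i p.-2; pos i p.-1; pos i p.+1; pos i p.+2].

(* Near the ends [pos] truncates, so that [nbrs c] may contain [c] itself. *)
Definition nbrs (c : node) : seq node :=
  if c.1 == m then
    if c.2 == 0 then [seq pos j 1 | j <- iota 0 m] ++ [seq pos j 2 | j <- iota 0 m]
    else [seq pos j (s j) | j <- iota 0 m] ++ [seq pos j (s j).-1 | j <- iota 0 m]
  else path_nbrs c.1 c.2 ++
    (if c.2 == 1 then [seq (j, 1) | j <- iota 0 m] else [::]) ++
    (if c.2 == s c.1 then [seq (j, s j) | j <- iota 0 m] else [::]).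

Definition cadj : rel node := fun c y => y \in nbrs c.

Definition valid (c : node) :=
  ((c.1 == m) && (c.2 <= 1)) || [&& c.1 < m, 0 < c.2 & c.2 <= s c.1].

Lemma cadj_path i p y : i < m -> cadj (i, p) y =
  [|| y \in path_nbrs i p, (p == 1) && (y \in [seq (j, 1) | j <- iota 0 m]) |
      (p == s i) && (y \in [seq (j, s j) | j <- iota 0 m])].
Proof.
move=> im; rewrite /cadj /nbrs [(i, p).1 == m]ltn_eqF //= -[_ :: _]/(path_nbrs i p ++ _).
by rewrite !mem_cat; do 2 case: ifP.
Qed.

Lemma cadj_source y : cadj (m, 0) y =
  (y \in [seq pos j 1 | j <- iota 0 m]) || (y \in [seq pos j 2 | j <- iota 0 m]).
Proof. by rewrite /cadj /nbrs eqxx mem_cat. Qed.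

Lemma cadj_sink y : cadj (m, 1) y =
  (y \in [seq pos j (s j) | j <- iota 0 m]) || (y \in [seq pos j (s j).-1 | j <- iota 0 m]).
Proof. by rewrite /cadj /nbrs eqxx mem_cat. Qed.

End Model.

(** The ends share the first coordinate [m], so for them it says that w precedes u. Being
    irreflexive, it also excludes repetitions. *)
Definition above (x y : node) := (x.1 == y.1) ==> (y.2 < x.2).

Lemma above_uniq O : pairwise above O -> uniq O.
Proof. by apply: pairwise_uniq => x; rewrite /above eqxx ltnn. Qed.

Lemma above_drop O c x y : pairwise above O -> y \in take c O -> x \in drop c O ->
  x.1 = y.1 -> x.2 < y.2.
Proof.
rewrite -{1}(cat_take_drop c O) pairwise_cat => /andP[/allrelP al _] yO xO xy.
by have := al y x yO xO; rewrite /above xy eqxx.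
Qed.

Definition run (i hi lo : nat) : seq node := [seq (i, hi - t) | t <- iota 0 (hi.+1 - lo)].

Lemma size_run i hi lo : size (run i hi lo) = hi.+1 - lo.
Proof. by rewrite size_map size_iota. Qed.

Lemma mem_run i hi lo c : 0 < lo -> (c \in run i hi lo) = (c.1 == i) && (lo <= c.2 <= hi).
Proof.
case: c => j q /= lo0; apply/mapP/andP => [[t]|[/eqP-> /andP[loq qhi]]].
  by rewrite mem_iota => /andP[_ tlt] [-> ->]; rewrite eqxx; split=> //; lia.
by exists (hi - q); [rewrite mem_iota; lia|congr pair; lia].
Qed.

Lemma run_above i hi lo : 0 < lo -> pairwise above (run i hi lo).
Proof.
move=> lo0; rewrite pairwise_map; apply/(pairwiseP 0) => a b.
rewrite !inE size_iota => a_lt b_lt ab; rewrite /= /above /= eqxx !nth_iota //; lia.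
Qed.

Lemma nth_run i hi lo h : h < hi.+1 - lo -> nth (0, 0) (run i hi lo) h = (i, hi - h).
Proof. by move=> hlt; rewrite (nth_map 0) ?size_iota // nth_iota. Qed.

Section Runs.
Implicit Types rs : seq (seq node).

Lemma flatten_above (F : nat -> seq node) (js : seq nat) : uniq js ->
  (forall i, pairwise above (F i)) -> (forall i c, c \in F i -> c.1 = i) ->
  pairwise above (flatten [seq F i | i <- js]).
Proof.
move=> ujs Fa Fi; elim: js ujs => //= j js IH /andP[jjs /IH ujs].
rewrite pairwise_cat Fa ujs /= andbT; apply/allrelP => x y /Fi xj /flatten_mapP[i ijs /Fi yi].
by rewrite /above xj yi; case: eqP jjs => //= ->; rewrite ijs.
Qed.

(* Five consecutive positions of a concatenation of runs of size at least 3
   always meet the third or a later position of some run. *)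
Lemma five_consecutive rs c : {in rs, forall R, 3 <= size R} ->
  c + 5 <= size (flatten rs) ->
  exists rs1 R rs2 h, [/\ rs = rs1 ++ R :: rs2, 2 <= h, h < size R,
    c + 2 <= size (flatten rs1) + h & size (flatten rs1) + h < c + 5].
Proof.
elim: rs c => [|R rs IH] c H3 /=; first by lia.
have R3 : 3 <= size R by apply: H3; rewrite inE eqxx.
rewrite size_cat => hc.
have [cR|cR] := ltnP (c + 2) (size R).
  by exists [::], R, rs, (c + 2); split=> //=; lia.
have [cR'|cR'] := leqP (size R) c.
  have [|| rs1 [R' [rs2 [h [-> h2 hR c2 c5]]]]] := IH (c - size R).
  - by move=> R' R's; apply: H3; rewrite inE R's orbT.
  - by lia.
  by exists (R :: rs1), R', rs2, h; split=> //=; rewrite size_cat; lia.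
case: rs {IH} H3 hc => [|R' rs] H3 /= hc; first by lia.
have R3' : 3 <= size R' by apply: H3; rewrite !inE eqxx orbT.
by exists [:: R], R', rs, 2; split=> //=; rewrite cats0; lia.
Qed.

Lemma mem_segment (O : seq node) c N i : c <= i < N -> i < size O ->
  nth (0, 0) O i \in drop c (take N O).
Proof.
move=> /andP[ci iN] iO; apply/(nthP (0, 0)); exists (i - c).
  have sz : size (drop c (take N O)) = minn N (size O) - c by rewrite size_drop size_take_min.
  by rewrite sz; lia.
by rewrite nth_drop nth_take ?subnKC.
Qed.

Lemma nth_runs (A B : seq node) rs1 R rs2 h :
  h < size R ->
  nth (0, 0) (A ++ flatten (rs1 ++ R :: rs2) ++ B) (size A + size (flatten rs1) + h)
  = nth (0, 0) R h.
Proof.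
move=> hR; rewrite flatten_cat /= -!catA nth_cat ifN; last by lia.
rewrite (_ : _ - size A = size (flatten rs1) + h); last by lia.
rewrite nth_cat ifN; last by lia.
by rewrite addKn nth_cat hR.
Qed.

End Runs.

Section Layered.
Variables (C : eqType) (adj : rel C) (k : nat).

(** A block decomposition that mentions no colour lists: an order is built once, and
    [layered_colorable] turns it into colourings for every [L]. *)
Inductive layered : seq C -> nat -> Prop :=
| Layered0 : layered [::] 0
| LayeredS A S q : layered A q -> admissible adj k A S -> layered (A ++ S) q.+1.

Lemma layered_small A : size A <= k -> layered A 1.
Proof.
move=> Ak; rewrite -[A]cat0s; apply: LayeredS; first exact: Layered0.
move=> [|t] tk; first by rewrite subn0 (leq_trans (count_size _ _)).
by rewrite (@eq_count _ _ pred0) ?count_pred0.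
Qed.

Lemma layered_take O c N q : c <= N -> layered (take c O) q ->
  admissible adj k (take c O) (drop c (take N O)) -> layered (take N O) q.+1.
Proof.
move=> cN lay adm; rewrite -(cat_take_drop c (take N O)) take_takel //.
exact: LayeredS.
Qed.

End Layered.

Lemma ceil_div_small N k : 0 < N -> N <= k -> ceil_div N k = 1.
Proof.
move=> N0 Nk; rewrite /ceil_div.
by rewrite (_ : N + k.-1 = 1 * k + N.-1) ?divnMDl ?divn_small //; lia.
Qed.

(** The last block runs from [c] to [N]. It may be shorter than [k] only when everything before it
    fits in one block, so that there are two blocks in all. *)
Lemma ceil_div_step N c k : 0 < k -> N - k <= c < N -> c <= k \/ c = N - k -> k < N ->
  ceil_div N k = (ceil_div c k).+1.
Proof.
move=> k0 cN cc kN; rewrite /ceil_div.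
have -> : N + k.-1 = k + (N - k + k.-1) by lia.
rewrite divnDl ?dvdnn // divnn k0 add1n; congr S.
have [ck|-> //] := cc; have c0 : 0 < c by lia.
rewrite (_ : N - k + k.-1 = 1 * k + (N - k).-1); last by lia.
rewrite (_ : c + k.-1 = 1 * k + c.-1); last by lia.
by rewrite !divnMDl ?divn_small //; lia.
Qed.

(** * Three paths or more, one of them long *)

Section LongPath.
Variables (m k a : nat) (s : nat -> nat).
Hypotheses (m3 : 3 <= m) (mk : m + 2 <= k).
Hypotheses (s0 : 0 < s 0) (s3 : forall i, 0 < i < m -> 3 <= s i) (s5 : 5 <= s m.-1).
Hypotheses (odds : forall i, i < m -> odd (s i)).
Hypotheses (am : a <= m.-1) (short_a : forall i, i < a -> s i <= 3).
Hypothesis (long_a : forall i, a <= i < m.-1 -> 5 <= s i).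

(* The order is [mid ++ tail]: first the neighbours of w and w itself, then the paths
   downwards (the [a] short ones first), and at the end the lowest vertices and u. The
   last path keeps its positions 4, 3, 2, 1 for [tail]; its position 5 is its only
   remaining one when [s m.-1 = 5], and then it counts as short. *)
Let T i := run i (s i).-1 2.
Let pm := run m.-1 (s m.-1) 5.
Let core := [seq (i, s i) | i <- iota 0 m.-1] ++ [:: (m, 1)].
Let shorts := (if s m.-1 == 5 then pm else [::]) ++ flatten [seq T i | i <- iota 0 a].
Let longs := [seq T i | i <- iota a (m.-1 - a)] ++ (if s m.-1 == 5 then [::] else [:: pm]).
Let front := core ++ shorts ++ flatten longs.
Let mid := front ++ (if s 0 == 1 then [::] else [:: (0, 1)]) ++ [:: (m - 2, 1)].
Let tail := [:: (m.-1, 4); (m.-1, 3); (m.-1, 2); (m.-1, 1)]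
  ++ [seq (j, 1) | j <- iota 1 (m - 3)] ++ [:: (m, 0)].

Lemma mem_T i c : (c \in T i) = (c.1 == i) && (2 <= c.2 < s i).
Proof.
rewrite mem_run //; case: (c.1 =P i) => //= _.
case: (s i) => [|n] /=; last by rewrite ltnS.
by case: c => c1 [|[|c2]].
Qed.

Lemma mem_pm c : (c \in pm) = (c.1 == m.-1) && (5 <= c.2 <= s m.-1).
Proof. by rewrite mem_run. Qed.

Lemma mem_flatT b n c :
  (c \in flatten [seq T i | i <- iota b n]) = (b <= c.1 < b + n) && (2 <= c.2 < s c.1).
Proof.
apply/flatten_mapP/andP => [[i]|[c1 c2]].
  by rewrite mem_iota mem_T => ib /andP[/eqP -> ->].
by exists c.1; rewrite ?mem_iota // mem_T eqxx.
Qed.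

Lemma mem_core c : (c \in core) = ((c.1 < m.-1) && (c.2 == s c.1)) || (c == (m, 1)).
Proof.
rewrite mem_cat inE; congr orb; apply/mapP/andP => [[i]|[c1 /eqP c2]].
  by rewrite mem_iota add0n => /andP[_ im] -> /=; rewrite im eqxx.
by exists c.1; rewrite ?mem_iota //; case: c c1 c2 => i q /= _ ->.
Qed.

Lemma mem_rest c : (c \in shorts ++ flatten longs) =
  (c.1 < m.-1) && (2 <= c.2 < s c.1) || (c.1 == m.-1) && (5 <= c.2 <= s m.-1).
Proof.
rewrite !mem_cat flatten_cat mem_cat !mem_flatT add0n subnKC //.
case: (s m.-1 =P 5) => E; rewrite /= ?cats0 ?mem_pm ?in_nil; case: c => i q /=; lia.
Qed.

Lemma mem_front c : (c \in front) = [|| c == (m, 1), (c.1 < m.-1) && (c.2 == s c.1),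
  (c.1 < m.-1) && (2 <= c.2 < s c.1) | (c.1 == m.-1) && (5 <= c.2 <= s m.-1)].
Proof. by rewrite mem_cat mem_rest mem_core -orbA orbCA. Qed.

Lemma mem_tail c : (c \in tail) = [|| c == (m, 0), (c.1 == m.-1) && (0 < c.2 < 5) |
  (0 < c.1 < m - 2) && (c.2 == 1)].
Proof.
rewrite !mem_cat !inE.
have -> : (c \in [seq (j, 1) | j <- iota 1 (m - 3)]) = (0 < c.1 < m - 2) && (c.2 == 1).
  apply/mapP/andP => [[j]|[c1 /eqP c2]].
    by rewrite mem_iota => jm -> /=; split=> //; lia.
  by exists c.1; rewrite ?mem_iota; [lia|case: c c1 c2 => i q /= _ ->].
by case: c => i q; rewrite !xpair_eqE /=; lia.
Qed.

Lemma mem_mid c : (c \in mid) =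
  [|| c \in front, (c == (0, 1)) && (s 0 != 1) | c == (m - 2, 1)].
Proof. by rewrite mem_cat mem_cat; case: (s 0 =P 1); rewrite /= ?inE ?andbT ?andbF. Qed.

Lemma longs_size3 : {in longs, forall R, 3 <= size R}.
Proof.
move=> R; rewrite mem_cat => /orP[/mapP[i]|].
  by rewrite mem_iota subnKC // => /long_a s_i ->; rewrite size_run; lia.
have := odds (i := m.-1); case: eqP => // s5' odd_p; rewrite inE => /eqP ->.
rewrite size_run; lia.
Qed.

(** All degree bounds rest on this: the neighbours of an inner vertex on its own path that come
    earlier can only be the two positions above it. *)
Lemma mid_tail_above : pairwise above (mid ++ tail).
Proof.
have coreA : pairwise above core.
  rewrite pairwise_cat /= andbT; apply/andP; split.
    apply/allrelP => x y; rewrite inE => /mapP[i]; rewrite mem_iota => im -> /eqP ->.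
    by rewrite /above /=; lia.
  rewrite pairwise_map; apply/(pairwiseP 0) => i j; rewrite !inE size_iota => im jm ij.
  by rewrite /= /above /= !nth_iota //; lia.
have TA b n : pairwise above (flatten [seq T i | i <- iota b n]).
  apply: flatten_above; first exact: iota_uniq.
    by move=> i; apply: run_above.
  by move=> i c; rewrite mem_T => /andP[/eqP].
have pmA : pairwise above pm by apply: run_above.
have restA : pairwise above (shorts ++ flatten longs).
  have Tpm b n : b + n <= m.-1 ->
      allrel above (flatten [seq T i | i <- iota b n]) pm /\
      allrel above pm (flatten [seq T i | i <- iota b n]).
    by move=> bn; split; apply/allrelP => -[i q] [j q'];
      rewrite !mem_flatT !mem_pm /above /=; lia.
  have TT : allrel above (flatten [seq T i | i <- iota 0 a])
      (flatten [seq T i | i <- iota a (m.-1 - a)]).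
    by apply/allrelP => -[i q] [j q']; rewrite !mem_flatT /above /=; lia.
  have [_ Ta] := Tpm 0 a ltac:(lia); have [Tb Tb'] := Tpm a (m.-1 - a) ltac:(lia).
  have [Ta' _] := Tpm 0 a ltac:(lia).
  rewrite /shorts /longs; case: (s m.-1 == 5); rewrite flatten_cat /= ?cats0;
  by rewrite !(pairwise_cat, allrel_catl, allrel_catr) ?TA ?pmA ?TT ?Ta ?Ta' ?Tb ?Tb'.
have frontA : pairwise above front.
  rewrite pairwise_cat coreA restA !andbT.
  apply/allrelP => -[i q] [j q'] xC yR; apply/implyP => /= /eqP ij.
  by move: xC yR; rewrite {}ij mem_core mem_rest xpair_eqE /=; lia.
have midA : pairwise above mid.
  rewrite pairwise_cat frontA; apply/and3P; split=> //.
    have s3z : 3 <= s (m - 2) by apply: s3; lia.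
    apply/allrelP => -[i q] [j q'] xF yE; apply/implyP => /= /eqP ij.
    move: xF yE; rewrite {}ij mem_front xpair_eqE mem_cat inE xpair_eqE /=.
    case: (s 0 =P 1) => s01; rewrite ?in_nil ?inE ?xpair_eqE /=.
      by move=> ? /andP[/eqP E]; rewrite -E in s3z; lia.
    by move=> ? /orP[/andP[/eqP E]|/andP[/eqP E]]; [|rewrite -E in s3z]; subst j; lia.
  by case: ifP => _ //=; rewrite /above /=; lia.
rewrite pairwise_cat midA; apply/and3P; split=> //.
  apply/allrelP => -[i q] [j q'] xM yT; apply/implyP => /= /eqP ij.
  move: xM yT; rewrite {}ij mem_mid mem_front mem_tail !xpair_eqE /= => xM yT.
  have [E|j0] := eqVneq j 0; first by move: xM yT; rewrite E; lia.
  have sj : j < m -> 3 <= s j by move=> jm; apply: s3; lia.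
  by lia.
rewrite pairwise_cat; apply/and3P; split.
- apply/allrelP => -[i q] [j q']; rewrite mem_cat !inE => xT /orP[/mapP[t]|].
    by rewrite mem_iota => tm [-> ->]; move: xT; rewrite /above !xpair_eqE /=; lia.
  by move: xT; rewrite /above !xpair_eqE /=; lia.
- by rewrite /= /above /=; lia.
rewrite pairwise_cat; apply/and3P; split=> //.
  apply/allrelP => -[i q] y; rewrite inE => /mapP[t]; rewrite mem_iota => tm -> /eqP ->.
  by rewrite /above /=; lia.
rewrite pairwise_map; apply/(pairwiseP 0) => i j; rewrite !inE size_iota => im jm ij.
by rewrite /= /above /= !nth_iota //; lia.
Qed.

Lemma mem_mid_tail c : (c \in mid ++ tail) = valid m s c.
Proof.
rewrite mem_cat mem_mid mem_front mem_tail /valid; case: c => i q; rewrite !xpair_eqE /=.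
have [im|im] := ltnP i m; last first.
  have -> : (i < m.-1) = false by lia. have -> : (i == m.-1) = false by lia.
  have -> : (i == 0) = false by lia. have -> : (i == m - 2) = false by lia.
  have -> : (i < m - 2) = false by lia. rewrite /= !andbF /= !orbF; lia.
have -> : (i == m) = false by lia.
have [E|i0] := eqVneq i 0.
  have -> : i < m.-1 by lia. have -> : (i == m.-1) = false by lia.
  have -> : (i == m - 2) = false by lia. rewrite E /= ?(andbF, orbF); lia.
have [E|iz] := eqVneq i m.-1.
  have -> : (i < m.-1) = false by lia. have -> : (i == m - 2) = false by lia.
  have -> : (i < m - 2) = false by lia. rewrite E /= ?(andbF, orbF); lia.
have -> : i < m.-1 by lia.
have := @s3 i ltac:(lia); have [E|iz2] := eqVneq i (m - 2).
  have -> : (i < m - 2) = false by lia. rewrite /= ?(andbF, orbF); lia.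
have -> : i < m - 2 by lia.
have -> : 0 < i by lia. rewrite /= ?(andbF, orbF); lia.
Qed.

Let midA : pairwise above mid.
Proof. by have := mid_tail_above; rewrite pairwise_cat => /and3P[]. Qed.

Lemma take_drop_mid c x y :
  y \in take c mid -> x \in drop c mid -> x.1 = y.1 -> x.2 < y.2.
Proof. exact: above_drop midA. Qed.

Lemma mid_notU c : (m, 0) \in take c mid = false.
Proof.
apply/negP => /mem_take; rewrite mem_mid mem_front !xpair_eqE /=; lia.
Qed.

Lemma mid_up c i q y : i < m -> 1 < q <= s i -> (i, q) \in drop c mid ->
  y \in take c mid -> y \in path_nbrs m s i q -> y \in [:: pos m s i q.+1; pos m s i q.+2].
Proof.
move=> im qs xD yM; rewrite !inE => /or4P[|| -> //|->]; rewrite ?orbT //; move=> /eqP E;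
  move: yM; rewrite {}E /pos; case: ifP => [_|q0]; rewrite ?mid_notU // ifT; try lia.
- by move=> yM; have /= := take_drop_mid yM xD (erefl i); lia.
- by move=> yM; have /= := take_drop_mid yM xD (erefl i); lia.
Qed.

Lemma mid_run_nbrs c i q y : i < m -> 1 < q < s i -> (i, q) \in drop c mid ->
  y \in take c mid -> cadj m s (i, q) y -> y \in [:: pos m s i q.+1; pos m s i q.+2].
Proof.
move=> im qs xD yM; rewrite cadj_path // => /or3P[yN|/andP[/eqP E]|/andP[/eqP E]]; try lia.
by apply: (mid_up im _ xD yM yN); lia.
Qed.

Lemma mid_top_nbrs c y : (m.-1, s m.-1) \in drop c mid ->
  y \in take c mid -> cadj m s (m.-1, s m.-1) y -> y != (m.-1, s m.-1) ->
  y \in (m, 1) :: [seq (j, s j) | j <- iota 0 m.-1].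
Proof.
move=> xD yM; rewrite cadj_path ?prednK //; last by lia.
move=> /or3P[yN _|/andP[/eqP E]|/andP[_ /mapP[j]]]; [|by lia|].
  have posW q : s m.-1 < q -> pos m s m.-1 q = (m, 1).
    by move=> sq; rewrite /pos !ifN //; lia.
  have := @mid_up c m.-1 (s m.-1) y ltac:(lia) ltac:(lia) xD yM yN.
  by rewrite (posW _ (ltnSn _)) (posW _ (leqnSn _)) !inE orbb => ->.
rewrite mem_iota => jm yE yx; move: yx; rewrite yE inE => yx; apply/orP; right.
apply/mapP; exists j => //; rewrite mem_iota; apply/andP; split=> //.
by case: (eqVneq j m.-1) yx => [->|]; rewrite ?eqxx //; lia.
Qed.

Lemma mid_last c y : (m - 2, 1) \in take c mid -> y \in drop c mid = false.
Proof.
move=> zT; apply/negP => yD; have := above_uniq midA.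
rewrite -(cat_take_drop c mid) cat_uniq => /and3P[_ /hasP H _]; apply: H.
exists (m - 2, 1) => //; move: yD; case E: (drop c mid) => [//|u v] _.
have <- : last (0, 0) mid = (m - 2, 1) by rewrite /mid catA last_cat.
by rewrite -(cat_take_drop c mid) E last_cat /= mem_last.
Qed.

Lemma mid_up1 c i y : y \in take c mid -> y \in path_nbrs m s i 1 ->
  y \in [:: pos m s i 2; pos m s i 3].
Proof.
rewrite !inE => yM /or4P[/eqP E|/eqP E|->|->]; rewrite ?orbT //;
  by move: yM; rewrite E mid_notU.
Qed.

Lemma mid_one c j : j < m -> (j, 1) \in take c mid -> (j == 0) || (j == m - 2).
Proof.
move=> jm /mem_take; rewrite mem_mid mem_front !xpair_eqE /=.
by have [//|j0] := eqVneq j 0; have := @s3 j ltac:(lia); lia.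
Qed.

(** [core] has [m] elements, so [m <= c] means that w and the tops of the first [m - 1] paths are
    coloured. Most vertices then see only the two positions above them; the top of the last path
    sees w and the other tops, and [(m - 2, 1)] also sees [(0, 1)]. As [m <= k - 2],
    [admissible_low] tolerates these two exceptions. *)
Lemma mid_low c x : m <= c -> x \in drop c mid ->
  deg (cadj m s) x (take c mid) <= (if x \in [:: (m.-1, s m.-1); (m - 2, 1)] then m else 2).
Proof.
move=> mc xD; have xM := mem_drop xD.
have xNT : x \notin take c mid.
  by apply/negP => xT; have := take_drop_mid xT xD erefl; rewrite ltnn.
have xNcore : x \notin core.
  have size_core : size core = m by rewrite size_cat size_map size_iota /=; lia.
  apply: contra xNT => xc; rewrite /mid /front -[(core ++ _) ++ _]catA take_cat ifN.
    by rewrite mem_cat xc.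
  by rewrite size_core -leqNgt.
move: xM xNcore; rewrite mem_mid mem_front mem_core !inE negb_or; case: x xD xNT => i q xD xNT.
have sz : 3 <= s (m - 2) by apply: s3; lia.
have [/eqP [Ei Eq] _ _|xz] := boolP ((i, q) == (m - 2, 1)).
  rewrite orbT; apply: leq_trans m3.
  pose B := [:: pos m s (m - 2) 2; pos m s (m - 2) 3; (0, 1)].
  apply: (@deg_le _ _ _ _ B) => y yM.
    rewrite Ei Eq cadj_path; last by lia.
    move=> /or3P[/(mid_up1 yM)|/andP[_ /mapP[j]]|/andP[/eqP E]]; last by lia.
      by rewrite !(inE, mem_cat) => /orP[]->; rewrite ?orbT.
    rewrite mem_iota add0n => /andP[_ jm] yE; move: yM; rewrite yE => /(mid_one jm).
    by rewrite !xpair_eqE eqxx !andbT => /orP[]/eqP-> /=; [rewrite !inE eqxx !orbT|rewrite eqxx].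
rewrite orbF; have [/eqP [Ei Eq] _ _|xp] := boolP ((i, q) == (m.-1, s m.-1)).
  apply: leq_trans (deg_le (B := (m, 1) :: [seq (j, s j) | j <- iota 0 m.-1]) _) _.
    by move=> y; rewrite Ei Eq; apply: mid_top_nbrs; rewrite -Eq -Ei.
  by rewrite /= size_map size_iota; lia.
move=> H1 H2; have [/eqP [Ei Eq]|x0] := boolP ((i, q) == (0, 1)).
  apply: (@deg_le _ _ _ _ [:: pos m s 0 2; pos m s 0 3]) => y yM.
  rewrite Ei Eq cadj_path; last by lia.
  move=> /or3P[/(mid_up1 yM) //|/andP[_ /mapP[j]]|/andP[/eqP E]]; last first.
    by move: H2; rewrite Ei Eq /= -E; clear -m3; lia.
  rewrite mem_iota add0n => /andP[_ jm] yE; move: yM; rewrite yE => yM.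
  move: xD; have [/eqP->|/eqP jE] := orP (mid_one jm yM); first by rewrite eqxx.
  by move: yM; rewrite jE => /mid_last ->.
have [im qs] : i < m /\ 1 < q < s i.
  by move: H1 H2 xz xp x0; rewrite !xpair_eqE /=; have [->|] := eqVneq i m.-1; lia.
apply: (@deg_le _ _ _ _ [:: pos m s i q.+1; pos m s i q.+2]) => y yM xy _.
exact: (mid_run_nbrs im qs xD yM xy).
Qed.

Lemma mid_disjoint c x : x \in take c mid -> x \in drop c mid -> False.
Proof. by move=> xT xD; have := take_drop_mid xT xD erefl; rewrite ltnn. Qed.

(** Both positions above [q] wait for the block itself, and so does one of the two above [q + 1]. *)
Lemma mid_triple c i q : i < m -> 1 < q -> q + 2 <= s i ->
  (i, q) \in drop c mid -> (i, q.+1) \in drop c mid -> (i, q.+2) \in drop c mid ->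
  deg (cadj m s) (i, q) (take c mid) = 0 /\ deg (cadj m s) (i, q.+1) (take c mid) <= 1.
Proof.
move=> im q1 qs D0 D1 D2.
have pos1 : pos m s i q.+1 = (i, q.+1) by rewrite /pos /= ifT //; lia.
have pos2 : pos m s i q.+2 = (i, q.+2) by rewrite /pos /= ifT //; lia.
split.
  apply: deg_eq0 => y yM xy; have qs' : 1 < q < s i by lia.
  have := mid_run_nbrs im qs' D0 yM xy; rewrite pos1 pos2 !inE => /orP[]/eqP yE.
    by case: (mid_disjoint yM); rewrite yE.
  by case: (mid_disjoint yM); rewrite yE.
apply: (@deg_le _ _ _ _ [:: pos m s i q.+3]) => y yM xy _.
have qs' : 1 < q.+1 < s i by lia.
have := mid_run_nbrs im qs' D1 yM xy; rewrite pos2 !inE => /orP[/eqP yE|//].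
by case: (mid_disjoint yM); rewrite yE.
Qed.

Definition has_triple c N := exists i q, [/\ i < m, 1 < q, q + 2 <= s i &
  [/\ (i, q) \in drop c (take N mid), (i, q.+1) \in drop c (take N mid) &
      (i, q.+2) \in drop c (take N mid)]].

Lemma sub_drop c N : {subset drop c (take N mid) <= drop c mid}.
Proof.
move=> x xD; have cA : c < size (take N mid).
  by rewrite ltnNge; apply/negP => /drop_oversize E; rewrite E in xD.
by rewrite -(cat_take_drop N mid) drop_cat cA mem_cat xD.
Qed.

Lemma mid_step c N : m <= c -> c < N <= size mid -> N - c <= k ->
  N - c <= k - 2 \/ has_triple c N ->
  admissible (cadj m s) k (take c mid) (drop c (take N mid)).
Proof.
move=> mc cN Nk trip.
have size_S : size (drop c (take N mid)) = N - c.
  by rewrite size_drop size_takel //; case/andP: cN.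
apply: (@admissible_low _ _ _ _ _ [:: (m.-1, s m.-1); (m - 2, 1)]) => //.
- by apply/drop_uniq/take_uniq/above_uniq.
- by rewrite size_S.
- move=> x /sub_drop xD; apply: leq_trans (mid_low mc xD) _.
  by case: ifP => // _; lia.
rewrite size_S; case: trip => [|[i [q [im q1 qs [D0 D1 D2]]]]]; [by left|right].
have [d0 d1] := mid_triple im q1 qs (sub_drop D0) (sub_drop D1) (sub_drop D2).
by exists (i, q), (i, q.+1); split=> //; rewrite xpair_eqE; lia.
Qed.

(** A short path leaves at most one vertex to [shorts], and so does the last path if it counts as
    short. Hence the long runs start no later than [2 * k - 4]. *)
Lemma size_base : size (core ++ shorts) <= 2 * m.
Proof.
have flat_le b : b <= a -> size (flatten [seq T i | i <- iota 0 b]) <= b.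
  elim: b => // b IH ba; rewrite -addn1 iotaD map_cat flatten_cat size_cat /= cats0 add0n size_run.
  by have := IH (ltnW ba); have := short_a ba; lia.
have := flat_le a (leqnn a).
rewrite size_cat [size shorts]size_cat [size core]size_cat size_map size_iota /=.
by case: ifP => [/eqP E|_] /=; rewrite ?size_run ?E; lia.
Qed.

Lemma find_triple c : 2 * k - 1 <= c + k <= size mid -> has_triple c (c + k).
Proof.
move=> /andP[ck cM]; set K0 := size (core ++ shorts).
have K0le := size_base; rewrite -/K0 in K0le.
have midE : mid = (core ++ shorts) ++ flatten longs ++ drop (size front) mid.
  by rewrite /mid drop_size_cat // /front !catA.
have size_mid : size mid <= K0 + size (flatten longs) + 2.
  rewrite /mid /front size_cat catA size_cat; case: ifP => _ /=; rewrite -/K0; lia.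
suff [rs1 [R [rs2 [h [longsE h2 hR hc hN]]]]] : exists rs1 R rs2 h,
    [/\ longs = rs1 ++ R :: rs2, 2 <= h, h < size R,
     c + 2 <= K0 + size (flatten rs1) + h & K0 + size (flatten rs1) + h < c + k].
  have [i [hi [lo [RE im lo2 his]]]] : exists i hi lo,
      [/\ R = run i hi lo, i < m, 2 <= lo & hi <= s i].
    have : R \in longs by rewrite longsE mem_cat inE eqxx orbT.
    rewrite mem_cat => /orP[/mapP[i]|].
      by rewrite mem_iota => im ->; exists i, (s i).-1, 2; split=> //; lia.
    by case: ifP => // _; rewrite inE => /eqP->; exists m.-1, (s m.-1), 5; split=> //; lia.
  have mem_h h' : h' <= h -> h - 2 <= h' -> (i, hi - h') \in drop c (take (c + k) mid).
    move=> h'h hh'; have h'R : h' < size R by lia.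
    have := nth_runs (core ++ shorts) (drop (size front) mid) rs1 rs2 h'R.
    rewrite -longsE -midE RE nth_run => [<-|]; last by move: h'R; rewrite RE size_run.
    apply: mem_segment; first by rewrite -/K0; lia.
    rewrite midE longsE flatten_cat /= !size_cat; lia.
  have hhi : h < hi.+1 - lo by move: hR; rewrite RE size_run.
  exists i, (hi - h); split=> //; try lia.
  rewrite (_ : (hi - h).+1 = hi - h.-1); last by lia.
  rewrite (_ : (hi - h.-1).+1 = hi - (h - 2)); last by lia.
  by split; apply: mem_h; lia.
have longs3 := longs_size3.
(* The block ends no earlier than [2 * k - 1 >= K0 + 3], so if it starts before the long runs it
   contains the first three vertices of the first of them. *)
have [cK|Kc] := ltnP c K0.
  case E : longs => [|R rs]; first by move: size_mid; rewrite E /=; lia.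
  exists [::], R, rs, 2; have := longs3 R; rewrite E inE eqxx => /(_ isT) R3.
  by split=> //=; lia.
have [c5|c5] := leqP (c - K0 + 5) (size (flatten longs)).
  have [rs1 [R [rs2 [h [-> h2 hR h3 h4]]]]] := five_consecutive longs3 c5.
  by exists rs1, R, rs2, h; split=> //; lia.
(* The block now starts too late for five vertices within the runs. At most two vertices of [mid]
   follow the runs and [k >= 5], so the block contains the last three vertices of the last run. *)
have [E|[rs [R E]]] : longs = [::] \/ exists rs R, longs = rcons rs R.
- by case: (lastP longs) => [|rs R]; [left|right; exists rs, R].
- by move: size_mid; rewrite E /=; lia.
have R3 : 3 <= size R by apply: longs3; rewrite E mem_rcons inE eqxx.
have sE : size (flatten longs) = size (flatten rs) + size R.
  by rewrite E -cats1 flatten_cat /= cats0 size_cat.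
exists rs, R, [::], (size R).-1; rewrite cats1; split=> //; lia.
Qed.

(** Full blocks are cut off from the end while the prefix has at least [2 * k - 1] vertices. Below
    that, a full first block leaves at most [k - 2] vertices, which need no triple. *)
Lemma mid_layered N : 0 < N <= size mid -> layered (cadj m s) k (take N mid) (ceil_div N k).
Proof.
elim/ltn_ind: N => N IH /andP[N0 NM].
have [Nk|kN] := leqP N k.
  by rewrite ceil_div_small //; apply: layered_small; rewrite size_takel.
have [Nsmall|Nbig] := ltnP N (2 * k - 1).
  rewrite (@ceil_div_step N k k) //; try lia.
  apply: (@layered_take _ _ _ _ k); [lia|by apply: IH; lia|].
  by apply: mid_step; [lia|lia|lia|left; lia].
rewrite (@ceil_div_step N (N - k) k) //; try lia.
apply: (@layered_take _ _ _ _ (N - k)); [lia|by apply: IH; lia|].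
apply: mid_step; [lia|lia|lia|right].
by have := @find_triple (N - k); rewrite subnK; [apply; lia|lia].
Qed.

Lemma mid_pathp c q : 0 < q -> (m.-1, q) \in take c mid -> 5 <= q.
Proof. by move=> q0 /mem_take; rewrite mem_mid mem_front !xpair_eqE /=; lia. Qed.

(** The first vertices of paths that may precede the last block; [(m - 2, 1)] is the last vertex of
    [mid] and precedes it only if all of [mid] does. *)
Let ends c := (0, 1) :: (if c < size mid then [::] else [:: (m - 2, 1)]).

Lemma mid_ones c j : j < m -> (j, 1) \in take c mid -> (j, 1) \in ends c.
Proof.
move=> jm jM; have [/eqP jE|/eqP jE] := orP (mid_one jm jM); first by rewrite jE inE eqxx.
rewrite /ends; case: ifP => cM; last by rewrite jE !inE eqxx orbT.
rewrite jE in jM; have := mid_last (m - 2, 1) jM.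
have -> // : (m - 2, 1) \in drop c mid.
have <- : last (0, 0) mid = (m - 2, 1) by rewrite /mid catA last_cat.
rewrite -{1}(cat_take_drop c mid) last_cat.
by case E: (drop c mid) => [|x l]; [move: (size_drop c mid); rewrite E /=; lia|rewrite /= mem_last].
Qed.

Lemma deg_U c : deg (cadj m s) (m, 0) (take c mid) <= size (ends c) + m.-1.
Proof.
rewrite -(size_iota 0 m.-1) -(size_map (fun j => pos m s j 2)) -size_cat.
apply: deg_le => y yM; rewrite cadj_source mem_cat.
have spos j : j < m -> 1 <= s j by have [->//|j0 jm] := eqVneq j 0; have := @s3 j; lia.
case/orP => /mapP[j]; rewrite mem_iota add0n => /andP[_ jm] yE _; apply/orP.
  have pE : pos m s j 1 = (j, 1) by rewrite /pos /= spos.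
  by left; move: yM; rewrite yE pE; apply: mid_ones.
right; rewrite yE; apply/mapP; exists j => //; rewrite mem_iota add0n /=.
move: yM; rewrite yE; have [->|] := eqVneq j m.-1; last by lia.
by rewrite /pos /= ifT; [move/mid_pathp => /(_ isT)|lia].
Qed.

Lemma deg_a c j : 0 < j < m.-1 -> deg (cadj m s) (j, 1) (take c mid) <= size (ends c) + 2.
Proof.
move=> jm; rewrite -[2]/(size [:: pos m s j 2; pos m s j 3]) -size_cat.
have sj : 3 <= s j by apply: s3; lia.
apply: deg_le => y yM; rewrite cadj_path; last by lia.
rewrite mem_cat => /or3P[/(mid_up1 yM) ->|/andP[_ /mapP[i im yE]]|/andP[/eqP E]] _; last by lia.
  by rewrite orbT.
move: im yM; rewrite mem_iota add0n yE => /andP[_ im] /(mid_ones im) -> //.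
Qed.

Lemma posp q : 0 < q <= 5 -> pos m s m.-1 q = (m.-1, q).
Proof. by move=> q5; rewrite /pos ifN ?ifT //; lia. Qed.

Lemma deg_p2 c : deg (cadj m s) (m.-1, 2) (take c mid) = 0.
Proof.
apply: deg_eq0 => y yM; rewrite cadj_path; last by lia.
case/or3P => [|/andP[/eqP]|/andP[/eqP E]]; [|by []|by lia].
rewrite !inE /pos /= !ifT; try lia.
by case/or4P => /eqP yE; move: yM; rewrite yE ?mid_notU // => /mid_pathp => /(_ isT).
Qed.

Lemma deg_p3 c : deg (cadj m s) (m.-1, 3) (take c mid) <= 1.
Proof.
apply: (@deg_le _ _ _ _ [:: pos m s m.-1 5]) => y yM; rewrite cadj_path; last by lia.
case/or3P => [|/andP[/eqP]|/andP[/eqP E]]; [|by []|by lia].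
rewrite inE /path_nbrs /= !inE {1 2 3}/pos /= !ifT; try lia.
by case/or4P => // /eqP yE; move: yM; rewrite yE => /mid_pathp => /(_ isT).
Qed.

Lemma deg_p1 c : deg (cadj m s) (m.-1, 1) (take c mid) <= size (ends c).
Proof.
apply: deg_le => y yM; rewrite cadj_path; last by lia.
case/or3P => [yN|/andP[_ /mapP[j jm yE]]|/andP[/eqP E]] _; last by lia.
  have := mid_up1 yM yN; rewrite !posp // !inE.
  by case/orP => /eqP yE; move: yM; rewrite yE => /mid_pathp => /(_ isT).
move: jm yM; rewrite mem_iota add0n yE => /andP[_ jm]; exact: mid_ones.
Qed.

Lemma deg_p4 c : deg (cadj m s) (m.-1, 4) (take c mid) <= 2.
Proof.
apply: (@deg_le _ _ _ _ [:: pos m s m.-1 5; pos m s m.-1 6]) => y yM.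
rewrite cadj_path; last by lia.
case/or3P => [|/andP[/eqP]|/andP[/eqP E]]; [|by []|by lia].
rewrite !inE {1 2}/pos /= !ifT; try lia.
by case/or4P => [/eqP yE|/eqP yE|->|->]; rewrite ?orbT //;
  move: yM; rewrite yE => /mid_pathp => /(_ isT).
Qed.

Lemma long_layered : layered (cadj m s) k (mid ++ tail) (ceil_div (size (mid ++ tail)) k).
Proof.
(* Placing [(0, 1)] and [(m - 2, 1)] at the end of [mid] at the latest keeps [tail] down to
   [m + 2 <= k] vertices, so that it fits in one block. *)
have size_tail : size tail = m + 2.
  by rewrite /tail size_cat size_cat size_map size_iota /=; lia.
have size_mid : m <= size mid.
  by rewrite /mid /front /core !size_cat size_map size_iota /=; lia.
have nE : size (mid ++ tail) = size mid + (m + 2) by rewrite size_cat size_tail.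
rewrite nE; have [nk|kn] := leqP (size mid + (m + 2)) k.
  by rewrite ceil_div_small //; [apply: layered_small; rewrite nE|lia].
(* The last block is [drop c mid ++ tail]. The first term keeps it within [k] vertices; the second
   fills the first block as far as [mid] allows, and gives [m <= c]. *)
pose c := maxn (size mid + (m + 2) - k) (minn k (size mid)).
rewrite (@ceil_div_step _ c k) //; try lia.
rewrite -{1}(cat_take_drop c mid) -catA; apply: LayeredS.
  by apply: mid_layered; lia.
have size_D : size (drop c mid) = size mid - c by rewrite size_drop.
have uS : uniq (drop c mid ++ tail).
  have := above_uniq mid_tail_above.
  by rewrite -{1}(cat_take_drop c mid) -catA cat_uniq => /and3P[].
have p2S : (m.-1, 2) \in drop c mid ++ tail by rewrite mem_cat mem_tail /= eqxx !orbT.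
have p3S : (m.-1, 3) \in drop c mid ++ tail by rewrite mem_cat mem_tail /= eqxx !orbT.
have [|H1 H2] := count_low uS p2S p3S _ (deg_p2 c) (deg_p3 c).
  by rewrite xpair_eqE andbF.
have size_S : size (drop c mid ++ tail) = size mid - c + (m + 2).
  by rewrite size_cat size_D size_tail.
move=> [|[|[|t]]] tk.
- by rewrite (leq_trans (count_size _ _)) // size_S; lia.
- by apply: leq_trans H1 _; rewrite size_S; lia.
- by apply: leq_trans H2 _; rewrite size_S; lia.
(* For [t >= 3] only u, the [m - 3] vertices [(j, 1)] and the two exceptions of [mid_low] can count.
   The exceptions matter only if [drop c mid] is nonempty, and then [(m - 2, 1)] is not yet coloured
   and [ends c] is a singleton. *)
set P := fun _ => _; rewrite count_cat.
have countD : count P (drop c mid) <= (if t.+3 <= m then minn 2 (size mid - c) else 0).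
  case: ifP => tm; last first.
    rewrite (@eq_in_count _ _ pred0) ?count_pred0 // => x xD; apply/negbTE.
    have := @mid_low c x ltac:(lia) xD; rewrite /P -ltnNge; case: ifP; lia.
  rewrite leq_min -size_D count_size andbT.
  apply: (@count_uniq_le _ _ _ [:: (m.-1, s m.-1); (m - 2, 1)]).
    by move: uS; rewrite cat_uniq => /andP[].
  by move=> x xD; have := @mid_low c x ltac:(lia) xD; rewrite /P; case: ifP => // _; lia.
have countT : count P tail <= (if t.+3 <= size (ends c) + 2 then m - 3 else 0) +
    (t.+3 <= size (ends c) + m.-1).
  have tailE : tail = [:: (m.-1, 4); (m.-1, 3); (m.-1, 2); (m.-1, 1)] ++
    ([seq (j, 1) | j <- iota 1 (m - 3)] ++ [:: (m, 0)]) by [].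
  have P0 q : 0 < q <= 4 -> P (m.-1, q) = false.
    move=> q4; apply/negbTE; rewrite /P -ltnNge ltnS; apply: (@leq_trans 2) => //.
    have : [|| q == 1, q == 2, q == 3 | q == 4] by lia.
    case/or4P => /eqP->.
    - by apply: leq_trans (deg_p1 c) _; rewrite /ends; case: ifP.
    - by rewrite deg_p2.
    - by apply: leq_trans (deg_p3 c) _.
    - exact: deg_p4.
  rewrite tailE count_cat /= !P0 // add0n count_cat /= addn0; apply: leq_add.
    case: ifP => [_|tm]; first by rewrite (leq_trans (count_size _ _)) ?size_map ?size_iota.
    rewrite (@eq_in_count _ _ pred0) ?count_pred0 // => x /mapP[j].
    rewrite mem_iota => jm ->; apply/negbTE.
    by have := @deg_a c j ltac:(lia); rewrite /P /=; lia.
  by have := deg_U c; rewrite /P /=; case: ltnP => //; case: leqP => //=; lia.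
have size_ends : size (ends c) = if c < size mid then 1 else 2 by rewrite /ends; case: ifP.
have cD : size mid - c + (m + 2) <= k by rewrite /c; lia.
have cM : c <= size mid by rewrite /c; lia.
move: countD countT; rewrite size_ends; clearbody c.
case: (ltnP c (size mid)) => E1; case: ifP => E2; case: ifP => E3; lia.
Qed.

Lemma long_order : exists O, [/\ uniq O, forall c, (c \in O) = valid m s c &
  layered (cadj m s) k O (ceil_div (size O) k)].
Proof.
exists (mid ++ tail); split; [exact: above_uniq mid_tail_above|exact: mem_mid_tail|].
exact: long_layered.
Qed.

End LongPath.

(** * Three paths or more, all of them short *)

(** On a path of length 2, [q = 1] is the edge at u, [q = 2] the middle vertex and [q = 3] the edge
    at w. On a path of length 1, [q = 1] is the edge uw. *)
Definition row (q b n : nat) : seq node := [seq (j, q) | j <- iota b n].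

Lemma mem_row q b n c : (c \in row q b n) = (b <= c.1 < b + n) && (c.2 == q).
Proof.
apply/mapP/andP => [[j]|[c1 /eqP c2]]; first by rewrite mem_iota => jb ->.
by exists c.1; rewrite ?mem_iota //; case: c c1 c2 => i p /= _ ->.
Qed.

Lemma size_row q b n : size (row q b n) = n.
Proof. by rewrite size_map size_iota. Qed.

Local Opaque row.

Section ShortPaths.
Variables (m k o : nat) (s : nat -> nat).
(* [o] is the number of paths of length 1, that is, of edges uw. *)
Hypotheses (o1 : o <= 1) (mk : m + 2 <= k).
Hypotheses (s_e : 0 < o -> s 0 = 1) (s_3 : forall i, o <= i < m -> s i = 3).
Let M := m - o.

Lemma cadj_a i y : o <= i < m -> cadj m s (i, 1) y ->
  [|| (y.1 == m) && (y.2 == 0), (y.1 == i) && (1 < y.2 <= 3) | (y.1 < m) && (y.2 == 1)].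
Proof.
move=> oi; rewrite cadj_path; last by lia.
case/or3P => [|/andP[_ /mapP[j]]|/andP[/eqP]]; last by rewrite s_3.
  by rewrite !inE /pos /= s_3 //=; case: y => j q /or4P[] /eqP[-> ->] /=; lia.
by rewrite mem_iota => jm ->; rewrite /=; lia.
Qed.

Lemma cadj_v i y : o <= i < m -> cadj m s (i, 2) y ->
  ((y.1 == m) && (y.2 <= 1)) || ((y.1 == i) && (1 <= y.2 <= 3)).
Proof.
move=> oi; rewrite cadj_path ?s_3 //=; last by lia.
rewrite orbF !inE /pos /= s_3 //=; case: y => j q /or4P[] /eqP[-> ->] /=; lia.
Qed.

Lemma cadj_b i y : o <= i < m -> cadj m s (i, 3) y ->
  [|| (y.1 == m) && (y.2 == 1), (y.1 == i) && (1 <= y.2 <= 2),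
      (o <= y.1 < m) && (y.2 == 3) | (y.1 < o) && (y.2 == 1)].
Proof.
move=> oi; rewrite cadj_path; last by lia.
case/or3P => [|//|/andP[_ /mapP[j]]].
  by rewrite !inE /pos /= s_3 //=; case: y => j q /or4P[] /eqP[-> ->] /=; lia.
rewrite mem_iota => jm ->; have [oj|jo] := leqP o j; first by rewrite s_3 /=; lia.
have E : j = 0 by lia.
by rewrite E s_e /=; lia.
Qed.

Lemma cadj_u y : cadj m s (m, 0) y ->
  [|| (y.1 < m) && (y.2 == 1), (o <= y.1 < m) && (y.2 == 2) | [&& 0 < o, y.1 == m & y.2 == 1]].
Proof.
rewrite cadj_source => /orP[] /mapP[j]; rewrite mem_iota => jm ->.
  have [oj|jo] := leqP o j; first by rewrite /pos s_3 /=; lia.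
  by rewrite (_ : j = 0) /pos ?s_e /=; lia.
have [oj|jo] := leqP o j; first by rewrite /pos s_3 /=; lia.
by rewrite (_ : j = 0) /pos ?s_e /=; lia.
Qed.

Lemma cadj_w y : cadj m s (m, 1) y ->
  [|| (o <= y.1 < m) && (1 < y.2 <= 3), (y.1 < o) && (y.2 == 1) | [&& 0 < o, y.1 == m & y.2 == 0]].
Proof.
rewrite cadj_sink => /orP[] /mapP[j]; rewrite mem_iota => jm ->.
  have [oj|jo] := leqP o j; first by rewrite /pos s_3 /=; lia.
  by rewrite (_ : j = 0) /pos ?s_e /=; lia.
have [oj|jo] := leqP o j; first by rewrite /pos s_3 /=; lia.
by rewrite (_ : j = 0) /pos ?s_e /=; lia.
Qed.

Lemma short_cover (P : pred node) : P (m, 0) -> P (m, 1) -> (0 < o -> P (0, 1)) ->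
  (forall i, o <= i < m -> [&& P (i, 1), P (i, 2) & P (i, 3)]) ->
  forall c, valid m s c -> P c.
Proof.
move=> P0 P1 Pe Pi [i q]; rewrite /valid /= => iq.
have [im|im] := ltnP i m; last first.
  have -> : i = m by lia.
  by have /orP[/eqP->|/eqP->] : (q == 0) || (q == 1) by lia.
have [io|oi] := ltnP i o.
  have i0 : i = 0 by lia.
  move: iq; rewrite i0 s_e; last by lia.
  move=> iq; have -> : q = 1 by lia.
  by apply: Pe; lia.
have := Pi i; rewrite oi im => /(_ isT) /and3P[].
move: iq; rewrite s_3; last by lia.
move=> iq; by have /or3P[/eqP->|/eqP->|/eqP->] : [|| q == 1, q == 2 | q == 3] by lia.
Qed.

Let inrow := (mem_cat, mem_row, in_nil).
Let szrow := (size_cat, size_row).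
Ltac split_or :=
  repeat match goal with |- is_true (_ || _) -> _ => case/orP end; move=> ?.

Ltac nbrs_in l lem :=
  apply: leq_trans (deg_le (B := l) _) _;
  [case=> ? ? /[swap] /lem; rewrite !inrow xpair_eqE /=; split_or; split_or; lia
  |rewrite ?szrow /=; lia].

Ltac count_le t tk :=
  move: tk; case: t => [|[|[|[|[|t]]]]] tk;
  repeat match goal with |- context [if ?a <= ?b then _ else _] =>
    first [change (a <= b) with true | change (a <= b) with false
          | case: (leqP a b) => ?]; cbv iota end; lia.

(** The first block leaves out [(o, 2)], so that [(o, 3)] sees at most the edge uw before the second
    block. It takes in two of the vertices [(j, 1)], so that only [M - 1] vertices remain for the
    third block, where degrees are high: for [o = 0] and [k = m + 2] the bound at [t = 3] is
    attained. *)
Lemma short_three : 3 <= M -> 2 * k < 3 * M + 2 + o ->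
  exists O, [/\ forall c, valid m s c -> c \in O, size O = 3 * M + 2 + o &
    layered (cadj m s) k O 3].
Proof.
move=> M3 kn.
pose B1 := row 0 m 1 ++ row 1 0 o ++ row 2 o.+1 (M - 1) ++ row 1 (m - 2) 2.
pose g2 := [:: (k - 1, row 1 m 1); (2 + o, row 3 (m - 2) 2);
  (1 + o, row 3 o.+1 (M - 3)); (o, row 3 o 1)].
pose S2 := row 1 m 1 ++ row 3 (m - 2) 2 ++ row 3 o.+1 (M - 3) ++ row 3 o 1 ++ [::].
pose g3 := [:: (5 + o, row 1 o.+1 (M - 3)); (4 + o, row 1 o 1); (3, row 2 o 1)].
pose S3 := row 1 o.+1 (M - 3) ++ row 1 o 1 ++ row 2 o 1 ++ [::].
exists ((B1 ++ S2) ++ S3); split.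
- by apply: short_cover => [|||i oi]; rewrite /= !inrow /= ?(andbF, orbF); lia.
- by rewrite !szrow /=; lia.
apply: LayeredS; first apply: LayeredS; first apply: layered_small.
- by rewrite !szrow; lia.
- apply: (admissible_groups (gs := g2)) => [|t tk]; last first.
    by rewrite /= !szrow; count_le t tk.
  do ?split=> //; move=> [i q] /=; rewrite !inrow /= => iq.
  + have -> : i = m by lia. have -> : q = 1 by lia.
    by nbrs_in (row 0 m 1 ++ row 1 0 o ++ row 2 o.+1 (M - 1)) cadj_w.
  + have -> : q = 3 by lia. have im : o <= i < m by lia.
    by nbrs_in (row 1 0 o ++ row 2 i 1 ++ row 1 i 1) (fun y => @cadj_b i y im).
  + have -> : q = 3 by lia. have im : o <= i < m by lia.
    by nbrs_in (row 1 0 o ++ row 2 i 1) (fun y => @cadj_b i y im).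
  + have -> : q = 3 by lia. have im : o <= i < m by lia.
    by nbrs_in (row 1 0 o) (fun y => @cadj_b i y im).
- apply: (admissible_groups (gs := g3)) => [|t tk]; last first.
    by rewrite /= !szrow; count_le t tk.
  do ?split=> //; move=> [i q] /=; rewrite !inrow /= => iq.
  + have -> : q = 1 by lia. have im : o <= i < m by lia.
    by nbrs_in (row 0 m 1 ++ row 1 0 o ++ row 1 (m - 2) 2 ++ row 2 i 1 ++ row 3 i 1)
      (fun y => @cadj_a i y im).
  + have -> : q = 1 by lia. have im : o <= i < m by lia.
    by nbrs_in (row 0 m 1 ++ row 1 0 o ++ row 1 (m - 2) 2 ++ row 3 i 1)
      (fun y => @cadj_a i y im).
  + have -> : q = 2 by lia. have im : o <= i < m by lia.
    by nbrs_in (row 0 m 1 ++ row 1 m 1 ++ row 3 i 1) (fun y => @cadj_v i y im).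
Qed.

Lemma short_two_free : o = 0 -> 3 <= M -> 3 * M + 2 <= 2 * k ->
  exists O, [/\ forall c, valid m s c -> c \in O, size O = 3 * M + 2 + o &
    layered (cadj m s) k O 2].
Proof.
(* As many middle vertices as fit, [c] of them, go to the second block of [M + 2 + c] vertices; the
   first has [2 * M - c]. With [(0, 2)] and [(0, 3)] kept back, [(0, 1)] has no neighbour in the
   first block. *)
move=> o0 M3 kn; pose c := minn (k - M - 2) M.
have [c0 cM cle Ac] : [/\ 0 < c, c <= M, M + 2 + c <= k & 2 * M - c <= k].
  by rewrite /c; split; lia.
pose A := row 1 m 1 ++ row 3 1 (M - 1) ++ row 2 c (M - c).
pose gs := [:: (M - c, row 0 m 1); (0, row 1 0 1); (1, row 1 1 (c - 1)); (2, row 1 c (M - c));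
  (M, row 3 0 1); (1, row 2 0 1); (2, row 2 1 (c - 1))].
clearbody c; exists (A ++ flatten [seq g.2 | g <- gs]); split.
- by apply: short_cover => [|||i oi]; rewrite /= !inrow /= ?(andbF, orbF); lia.
- by rewrite /= !szrow /=; lia.
apply: LayeredS; first by apply: layered_small; rewrite !szrow; lia.
apply: admissible_groups => [|t tk]; last first.
  by rewrite /= !szrow; count_le t tk.
do ?split=> //; move=> [i q] /=; rewrite !inrow /= => iq.
- have -> : i = m by lia. have -> : q = 0 by lia.
  by nbrs_in (row 2 c (M - c)) cadj_u.
- have -> : q = 1 by lia. have im : o <= i < m by lia.
  by nbrs_in (Nil node) (fun y => @cadj_a i y im).
- have -> : q = 1 by lia. have im : o <= i < m by lia.
  by nbrs_in (row 3 i 1) (fun y => @cadj_a i y im).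
- have -> : q = 1 by lia. have im : o <= i < m by lia.
  by nbrs_in (row 2 i 1 ++ row 3 i 1) (fun y => @cadj_a i y im).
- have -> : q = 3 by lia. have im : o <= i < m by lia.
  by nbrs_in (row 1 m 1 ++ row 3 1 (M - 1)) (fun y => @cadj_b i y im).
- have -> : q = 2 by lia. have im : o <= i < m by lia.
  by nbrs_in (row 1 m 1) (fun y => @cadj_v i y im).
- have -> : q = 2 by lia. have im : o <= i < m by lia.
  by nbrs_in (row 1 m 1 ++ row 3 i 1) (fun y => @cadj_v i y im).
Qed.

(** The edge uw, in the first block, is adjacent to both ends and to every other edge, so only a
    middle vertex can have no coloured neighbour. This is [(1, 2)], for whose sake both ends,
    [(1, 1)] and [(1, 3)] wait for the second block. *)
Lemma short_two_edge : o = 1 -> 3 <= M -> M + 4 <= k -> 3 * M + 3 <= 2 * k ->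
  exists O, [/\ forall c, valid m s c -> c \in O, size O = 3 * M + 2 + o &
    layered (cadj m s) k O 2].
Proof.
move=> oE M3 k4 kn; pose c := minn (k - M - 2) (M - 1).
have [c2 cM cle Ac] : [/\ 1 < c, c < M, M + 2 + c <= k & 2 * M + 1 - c <= k].
  by rewrite /c; split; lia.
have um : 2 * M - c < k by rewrite /c; lia.
pose A := row 1 0 1 ++ row 1 M 1 ++ row 3 2 (M - 1) ++ row 2 c.+1 (M - c).
pose gs := [:: (M + 2 - c, row 0 m 1); (2 * M - c, row 1 m 1); (2, row 1 1 1);
  (3, row 1 2 (c - 1)); (4, row 1 c.+1 (M - 1 - c)); (M, row 3 1 1);
  (0, row 2 1 1); (1, row 2 2 (c - 1))].
clearbody c; exists (A ++ flatten [seq g.2 | g <- gs]); split.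
- by apply: short_cover => [|||i oi]; rewrite /= !inrow /= ?(andbF, orbF); lia.
- by rewrite /= !szrow /=; lia.
apply: LayeredS; first by apply: layered_small; rewrite !szrow; lia.
apply: admissible_groups => [|t tk]; last first.
  by rewrite /= !szrow; count_le t tk.
do ?split=> //; move=> [i q] /=; rewrite !inrow /= => iq.
- have -> : i = m by lia. have -> : q = 0 by lia.
  by nbrs_in (row 1 0 1 ++ row 1 M 1 ++ row 2 c.+1 (M - c)) cadj_u.
- have -> : i = m by lia. have -> : q = 1 by lia.
  by nbrs_in (row 1 0 1 ++ row 3 2 (M - 1) ++ row 2 c.+1 (M - c)) cadj_w.
- have -> : q = 1 by lia. have im : o <= i < m by lia.
  by nbrs_in (row 1 0 1 ++ row 1 M 1) (fun y => @cadj_a i y im).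
- have -> : q = 1 by lia. have im : o <= i < m by lia.
  by nbrs_in (row 1 0 1 ++ row 1 M 1 ++ row 3 i 1) (fun y => @cadj_a i y im).
- have -> : q = 1 by lia. have im : o <= i < m by lia.
  by nbrs_in (row 1 0 1 ++ row 1 M 1 ++ row 2 i 1 ++ row 3 i 1) (fun y => @cadj_a i y im).
- have -> : q = 3 by lia. have im : o <= i < m by lia.
  by nbrs_in (row 1 0 1 ++ row 3 2 (M - 1)) (fun y => @cadj_b i y im).
- have -> : q = 2 by lia. have im : o <= i < m by lia.
  by nbrs_in (Nil node) (fun y => @cadj_v i y im).
- have -> : q = 2 by lia. have im : o <= i < m by lia.
  by nbrs_in (row 3 i 1) (fun y => @cadj_v i y im).
Qed.

(** Of the nine vertices, w, the edge uw and the last path come first. The four others have at most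
    4, 2, 1 and 3 coloured neighbours, which just meets the bounds when [k = 5]. *)
Lemma short_two_small : o = 1 -> M = 2 ->
  exists O, [/\ forall c, valid m s c -> c \in O, size O = 3 * M + 2 + o &
    layered (cadj m s) k O 2].
Proof.
move=> oE M2.
pose A := row 1 m 1 ++ row 1 0 1 ++ row 1 2 1 ++ row 2 2 1 ++ row 3 2 1.
pose gs := [:: (4, row 0 m 1); (2, row 1 1 1); (1, row 2 1 1); (3, row 3 1 1)].
exists (A ++ flatten [seq g.2 | g <- gs]); split.
- by apply: short_cover => [|||i oi]; rewrite /= !inrow /= ?(andbF, orbF); lia.
- by rewrite /= !szrow /=; lia.
apply: LayeredS; first by apply: layered_small; rewrite !szrow; lia.
apply: admissible_groups => [|t tk]; last first.
  by rewrite /= !szrow; count_le t tk.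
do ?split=> //; move=> [i q] /=; rewrite !inrow /= => iq.
- have -> : i = m by lia. have -> : q = 0 by lia.
  by nbrs_in (row 1 m 1 ++ row 1 0 1 ++ row 1 2 1 ++ row 2 2 1) cadj_u.
- have -> : q = 1 by lia. have im : o <= i < m by lia.
  by nbrs_in (row 1 0 1 ++ row 1 2 1) (fun y => @cadj_a i y im).
- have -> : q = 2 by lia. have im : o <= i < m by lia.
  by nbrs_in (row 1 m 1) (fun y => @cadj_v i y im).
- have -> : q = 3 by lia. have im : o <= i < m by lia.
  by nbrs_in (row 1 m 1 ++ row 1 0 1 ++ row 3 2 1) (fun y => @cadj_b i y im).
Qed.

End ShortPaths.

(** * The graph Theta(1, 2, 2, 2) with lists of size 6 *)

Lemma fresh_color (l forb : seq nat) : uniq l -> size forb < size l ->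
  exists2 c, c \in l & c \notin forb.
Proof.
move=> ul lt; apply/hasP; apply: contraTT lt => /hasPn H; rewrite -leqNgt.
by apply: uniq_leq_size => // c cl; move: (H c cl); rewrite negbK.
Qed.

(** A greedy choice may use up all four colours kept from [V]. As [U] and [B] are disjoint they have
    five colours together, one of them, [x], outside these four; making [x] the choice from [U] or
    [B], unless it is taken already, saves a colour for [v]. Disjointness also keeps the choice from
    [U] from blocking [B]. *)
Lemma five_representatives (U W A B V : seq nat) :
  uniq U -> uniq W -> uniq A -> uniq B -> uniq V ->
  2 <= size U -> 2 <= size W -> 3 <= size A -> 3 <= size B -> 4 <= size V ->
  {in U, forall c, c \notin B} ->
  exists u w a b v, [/\ uniq [:: u; w; a; b; v], u \in U, w \in W, a \in A & b \in B /\ v \in V].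
Proof.
move=> uU uW uA uB uV sU sW sA sB sV dUB.
have [x xUB xV] : exists2 x, x \in U ++ B & x \notin take 4 V.
  apply: fresh_color; last by rewrite size_takel // size_cat; lia.
  rewrite cat_uniq uU uB andbT; apply/hasPn => c cB; apply/negP => cU.
  by have := dUB c cU; rewrite cB.
suff [u [w [a [b [uwab [uU' wW aA bB] xx]]]]] : exists u w a b,
    [/\ uniq [:: u; w; a; b], [/\ u \in U, w \in W, a \in A & b \in B] & x \in [:: u; w; a; b]].
  have [v vV vN] : exists2 v, v \in take 4 V & v \notin rem x [:: u; w; a; b].
    by apply: fresh_color; rewrite ?take_uniq // size_rem // size_takel.
  exists u, w, a, b, v; split=> //; last by split=> //; apply: mem_take vV.
  have vx : v != x by apply: contraNneq xV => <-.
  have : v \notin [:: u; w; a; b].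
    by apply: contra vN => vN; rewrite mem_rem_uniq // !inE vx; move: vN; rewrite !inE.
  by rewrite (rcons_uniq [:: u; w; a; b] v) uwab andbT.
have [u uU' ux] : exists2 u, u \in U & (x \in U) ==> (u == x).
  case xU: (x \in U); first by exists x; rewrite ?xU /= ?eqxx.
  by case: U sU {uU dUB xUB xU} => [|u U _] //; exists u; rewrite ?inE ?eqxx.
have [w wW wN] := @fresh_color W [:: u] uW sW.
have [a aA aN] := @fresh_color A [:: u; w] uA sA.
have [b bB [bN bx]] : exists2 b, b \in B & b \notin [:: u; w; a] /\ x \in [:: u; w; a; b].
  case xin: (x \in [:: u; w; a]).
    have [b bB bN] := @fresh_color B [:: w; a] uB sB.
    exists b => //; split; last by move: xin; rewrite !inE => /or3P[] ->; rewrite ?orbT.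
    by rewrite inE negb_or bN andbT; apply: contraNneq (dUB u uU') => <-.
  exists x; last by rewrite xin !inE eqxx !orbT.
  move: xUB ux; rewrite mem_cat => /orP[->|//] /= /eqP E.
  by move: xin; rewrite E inE eqxx.
exists u, w, a, b; split=> //.
by rewrite (rcons_uniq [:: u; w; a] b) bN (rcons_uniq [:: u; w] a) aN (rcons_uniq [:: u] w) wN.
Qed.

(** * Blocks with prescribed colours *)

Section Special.
Variables (T : finType) (r : rel T) (L : T -> seq nat) (k : nat).
Variables (C : eqType) (x0 : C) (code : T -> C).
Hypotheses (r_sym : symmetric r) (r_irr : forall x, ~~ r x x).
Hypotheses (L_uniq : forall v, uniq (L v)) (L_size : forall v, size (L v) = k).
Hypotheses (code_inj : injective code).
Let inA A := coded code A.

Lemma assign_block f A cs cols q : partial_coloring r L f (inA A) q ->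
  uniq (A ++ cs) -> uniq cols -> size cols = size cs ->
  (forall i x, i < size cs -> code x = nth x0 cs i ->
     nth 0 cols i \in available r L f (inA A) x) ->
  exists f', [/\ partial_coloring r L f' (inA (A ++ cs)) q.+1,
    {in inA A, f' =1 f} &
    forall i x, i < size cs -> code x = nth x0 cs i -> f' x = nth 0 cols i].
Proof.
move=> fA uAcs ucols sz Hcols.
have Acs c : c \in cs -> c \notin A.
  by move=> ccs; move: uAcs; rewrite cat_uniq => /and3P[_ /hasPn H _]; apply: H.
have ucs : uniq cs by move: uAcs; rewrite cat_uniq => /and3P[].
pose g x := nth 0 cols (index (code x) cs).
exists (fun x => if x \in inA A then f x else g x); split.
- rewrite /inA coded_cat; apply: glue_block => //; first exact: coded_disjoint.
    move=> x; rewrite inE => /andP[xcs _]; apply: Hcols; first by rewrite index_mem.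
    by rewrite nth_index.
  move=> x y; rewrite !inE => /andP[xcs _] /andP[ycs _] /eqP.
  rewrite nth_uniq ?sz ?index_mem // => /eqP E; apply: code_inj.
  by rewrite -(nth_index x0 xcs) E nth_index.
- by move=> x /= ->.
- move=> i x ics xE; rewrite inE xE (negbTE (Acs _ (mem_nth _ ics))).
  by rewrite /g xE index_uniq.
Qed.

Variable adj : rel C.
Hypothesis code_adj : forall x y, r x y -> adj (code x) (code y).

Lemma available_deg f A x : code x \notin A ->
  k <= size (available r L f (inA A) x) + deg adj (code x) A.
Proof.
move=> xA; apply: leq_trans (available_size r L_uniq L_size f (inA A) x) _; rewrite leq_add2l.
apply: leq_trans (card_nbrs code_inj code_adj xA).
by apply/subset_leq_card/subsetP=> y; rewrite !inE => /and3P[-> ->].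
Qed.

Lemma available_deg_rem f A x y : code x \notin A -> code y \in A -> uniq A ->
  ~~ (r x y && (f y \in L x)) ->
  k <= size (available r L f (inA A) x) + deg adj (code x) (rem (code y) A).
Proof.
move=> xA yA uA fy; apply: leq_trans (available_size r L_uniq L_size f (inA A) x) _.
rewrite leq_add2l; apply: leq_trans (card_nbrs code_inj code_adj _); last first.
  by apply: contra xA => /mem_rem.
apply/subset_leq_card/subsetP=> z; rewrite !inE => /and3P[zA rxz fz].
rewrite rxz andbT mem_rem_uniq // !inE zA andbT.
by apply: contra fy => /eqP/code_inj <-; rewrite rxz fz.
Qed.

End Special.

Section SpecialFour.
Let s1 i := if i == 0 then 1 else 3.
Let adj := cadj 4 s1.
Variables (T : finType) (r : rel T) (L : T -> seq nat) (code : T -> nat * nat).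
Hypotheses (r_sym : symmetric r) (r_irr : forall x, ~~ r x x).
Hypotheses (L_uniq : forall v, uniq (L v)) (L_size : forall v, size (L v) = 6).
Hypotheses (code_inj : injective code).
Hypothesis code_adj : forall x y, r x y -> adj (code x) (code y).
Variable dec : nat * nat -> T.
Hypothesis decK : forall c, valid 4 s1 c -> code (dec c) = c.

(* [h] chooses one of the two ends, so that every construction also covers its mirror
   image. *)
Let cu (h : bool) := (4, h : nat).
Let ca (h : bool) (i : nat) := (i, if h then 3 else 1).
Let first_block (h : bool) (i : nat) :=
  [:: (0, 1); ca h (3 - i); ca h 3; ca (~~ h) (3 - i); ca (~~ h) 3; (3, 2)].
Let second_block (h : bool) (i : nat) :=
  [:: cu h; cu (~~ h); ca h i; ca (~~ h) i; (3 - i, 2); (i, 2)].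

Lemma filter_common (l l' : seq nat) : uniq l ->
  {in l &, forall c c', c \in l' -> c' \in l' -> c = c'} ->
  size l <= (size [seq c <- l | c \notin l']).+1.
Proof.
move=> ul H; suff : count (mem l') l <= 1.
  by move=> le1; rewrite size_filter -(count_predC (mem l') l) addnC -addn1 leq_add2l.
rewrite -size_filter.
case E: [seq c <- l | mem l' c] => [//|x [//|y t]].
have inE' c : c \in [:: x, y & t] -> c \in l /\ c \in l'.
  by rewrite -E mem_filter => /andP[? ?].
have [] := inE' x; first by rewrite inE eqxx.
have [] := inE' y; first by rewrite !inE eqxx orbT.
move=> yl yl' xl xl'; have : uniq [:: x, y & t] by rewrite -E filter_uniq.
by rewrite /= inE (H x y xl yl xl' yl') eqxx.
Qed.

(* If the lists of the end [cu h] and of the vertex [ca (~~ h) i] near the other end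
   share at most one colour, then a system of distinct colours for the second block
   exists: [five_representatives] needs the two colour sets to be disjoint. *)
Lemma special_plain h i : 0 < i < 3 ->
  (forall c c', c \in L (dec (cu h)) -> c \in L (dec (ca (~~ h) i)) ->
     c' \in L (dec (cu h)) -> c' \in L (dec (ca (~~ h) i)) -> c = c') ->
  colorable r L code (first_block h i ++ second_block h i) 2.
Proof.
move=> i3 common; set A := first_block h i.
have [f fA] : colorable r L code A 1.
  by apply: (@colorable_small _ adj _ _ _ 6).
have [vS vA uAS adj_e adj_e'] : [/\ all (valid 4 s1) (second_block h i), all (valid 4 s1) A,
    uniq (A ++ second_block h i), adj (cu h) (0, 1) & adj (ca (~~ h) i) (0, 1)].
  by rewrite /A; case: (h); case: (i) i3 => [|[|[|]]] // _; split; vm_compute.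
(* These degrees leave 2, 2, 3, 3 and 4 of the six colours, the sizes in [five_representatives]. The
   sixth vertex keeps all six and is coloured last. *)
have [dU dW dA dB dV] : [/\ deg adj (cu h) A <= 4, deg adj (cu (~~ h)) A <= 4,
    deg adj (ca h i) A <= 3, deg adj (ca (~~ h) i) A <= 3 & deg adj (3 - i, 2) A <= 2].
  by rewrite /A; case: (h); case: (i) i3 => [|[|[|]]] // _; split; vm_compute.
have [dV' dU' dB'] : [/\ deg adj (i, 2) A <= 0, deg adj (cu h) (rem (0, 1) A) <= 3 &
    deg adj (ca (~~ h) i) (rem (0, 1) A) <= 2].
  by rewrite /A; case: (h); case: (i) i3 => [|[|[|]]] // _; split; vm_compute.
have uA : uniq A by move: uAS; rewrite cat_uniq => /and3P[].
have notA c : c \in second_block h i -> code (dec c) \notin A.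
  move=> cS; rewrite decK; last exact: (allP vS).
  by move: uAS; rewrite cat_uniq => /and3P[_ /hasPn H _]; apply: H.
have codeS c : c \in second_block h i -> code (dec c) = c by move=> /(allP vS)/decK.
pose av c := available r L f (coded code A) (dec c).
have avu c : uniq (av c) by apply: available_uniq.
have av_size c d : c \in second_block h i -> deg adj c A <= d -> 6 - d <= size (av c).
  move=> cS; have := available_deg L_uniq L_size code_inj code_adj f (notA c cS).
  rewrite (codeS c cS) -/(av c); move: (deg _ _ _) (size _); clear; lia.
have e_A : code (dec (0, 1)) \in A by rewrite decK // inE eqxx.
have av_e c d : c \in second_block h i -> deg adj c (rem (0, 1) A) <= d ->
    ~~ (r (dec c) (dec (0, 1)) && (f (dec (0, 1)) \in L (dec c))) -> 6 - d <= size (av c).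
  move=> cS dc fe; have := available_deg_rem L_uniq L_size code_inj code_adj (notA c cS) e_A uA fe.
  rewrite (codeS c cS) decK // -/(av c) => H; move: H dc.
  by move: (deg _ _ _) (size _); clear; lia.
have av_L c x : x \in av c -> x \in L (dec c) by rewrite mem_filter => /andP[].
pose u := cu h; pose b := ca (~~ h) i.
have uS : u \in second_block h i by rewrite inE eqxx.
have bS : b \in second_block h i by rewrite !inE eqxx !orbT.
have common' : {in av u & av b, forall x y, x \in av b -> y \in av u -> x = y}.
  by move=> x y xu yb xb yu; apply: common; apply: av_L.
have [U [B [[uU sU subU] [uB sB subB] dUB]]] : exists U B,
    [/\ [/\ uniq U, 2 <= size U & {subset U <= av u}],
        [/\ uniq B, 3 <= size B & {subset B <= av b}] & {in U, forall c, c \notin B}].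
  (* If the colour of the edge uw costs [u] nothing, [av u] has three colours and can give up the
     one it may share with [av b]; below, likewise with [b] in place of [u]. *)
  have [/andP[rue eu]|Nu] := boolP (r (dec u) (dec (0, 1)) && (f (dec (0, 1)) \in L (dec u))); last first.
    have sU := av_e u 3 uS dU' Nu.
    exists [seq c <- av u | c \notin av b], (av b); split; first split.
    - exact: filter_uniq.
    - have := @filter_common (av u) (av b) (avu u); move: sU.
      set m1 := size (av u); set m2 := size _ => sU H.
      have : m1 <= m2.+1 by apply: H => x y xu yu xb yb; apply: common'.
      by move: sU; clear; lia.
    - by move=> c; rewrite mem_filter => /andP[].
    - by split=> //; have := av_size b 3 bS dB.
    - by move=> c; rewrite mem_filter => /andP[].
  have [/andP[rbe eb]|Nb] := boolP (r (dec b) (dec (0, 1)) && (f (dec (0, 1)) \in L (dec b))); last first.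
    have sB := av_e b 2 bS dB' Nb.
    exists (av u), [seq c <- av b | c \notin av u]; split; first split=> //.
    - by have := av_size u 4 uS dU.
    - split; first exact: filter_uniq.
        have := @filter_common (av b) (av u) (avu b); move: sB.
        set m1 := size (av b); set m2 := size _ => sB H.
        have : m1 <= m2.+1 by apply: H => x y xb yb xu yu; apply: common'.
        by move: sB; clear; lia.
      by move=> c; rewrite mem_filter => /andP[].
    - by move=> c cu'; rewrite mem_filter cu'.
  exists (av u), (av b); split.
  - by split=> //; have := av_size u 4 uS dU.
  - by split=> //; have := av_size b 3 bS dB.
  - move=> c cu'; apply/negP => cb.
    have cE : c = f (dec (0, 1)) by apply: common => //; apply: av_L.
    have := available_notin (x := dec u) (y := dec (0, 1)) cu'.
    by rewrite inE e_A rue -cE eqxx => /(_ isT isT).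
have [x1 [x2 [x3 [x4 [x5 [ux x1U x2W x3A [x4B x5V]]]]]]] :=
  @five_representatives U (av (cu (~~ h))) (av (ca h i)) B (av (3 - i, 2)) uU (avu _) (avu _) uB
    (avu _) sU (av_size (cu (~~ h)) 4 ltac:(by rewrite !inE eqxx ?orbT) dW)
    (av_size (ca h i) 3 ltac:(by rewrite !inE eqxx ?orbT) dA) sB
    (av_size (3 - i, 2) 2 ltac:(by rewrite !inE eqxx ?orbT) dV) dUB.
have [x6 x6V x6N] := @fresh_color (av (i, 2)) [:: x1; x2; x3; x4; x5] (avu _)
  (av_size (i, 2) 0 ltac:(by rewrite !inE eqxx ?orbT) dV').
have [|||f' [f'P _ _]] := assign_block (x0 := (0, 0)) r_sym r_irr code_inj
  (cols := [:: x1; x2; x3; x4; x5; x6]) fA uAS; last by exists f'.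
- by rewrite (rcons_uniq [:: x1; x2; x3; x4; x5] x6) x6N.
- by [].
move=> j x jlt xE; have -> : x = dec (nth (0, 0) (second_block h i) j).
  have nS : nth (0, 0) (second_block h i) j \in second_block h i by exact: mem_nth.
  by apply: code_inj; rewrite xE (codeS _ nS).
by move: j jlt {xE} => [|[|[|[|[|[|//]]]]]] _ //=; [apply: subU|apply: subB].
Qed.

Hypothesis r_adj : forall x y, adj (code x) (code y) -> code x != code y -> r x y.

Let A2 := [:: (2, 3); (2, 1); (0, 1); (3, 1); (3, 3); (3, 2)].
Let S2 := [:: (4, 0); (4, 1); (1, 1); (1, 3); (2, 2); (1, 2)].

(* Reusing [c] on [(4, 0)] and [(2, 3)], and [d] on [(4, 1)] and [(2, 1)], makes the
   vertices of the second block lose fewer colours. *)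
Lemma special_matched c d : c != d ->
  c \in L (dec (4, 0)) -> c \in L (dec (2, 3)) -> d \in L (dec (4, 1)) -> d \in L (dec (2, 1)) ->
  colorable r L code (A2 ++ S2) 2.
Proof.
move=> cd cU cB dW dA.
have [x1 x1L x1N] := @fresh_color (L (dec (0, 1))) [:: c; d] (L_uniq _) ltac:(by rewrite L_size).
have [x2 x2L x2N] := @fresh_color (L (dec (3, 1))) [:: c; d; x1] (L_uniq _) ltac:(by rewrite L_size).
have [x3 x3L x3N] := @fresh_color (L (dec (3, 3))) [:: c; d; x1; x2] (L_uniq _)
  ltac:(by rewrite L_size).
have [x4 x4L x4N] := @fresh_color (L (dec (3, 2))) [:: c; d; x1; x2; x3] (L_uniq _)
  ltac:(by rewrite L_size).
set cols := [:: c; d; x1; x2; x3; x4].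
have ucols : uniq cols.
  rewrite (rcons_uniq [:: c; d; x1; x2; x3] x4) x4N (rcons_uniq [:: c; d; x1; x2] x3) x3N.
  by rewrite (rcons_uniq [:: c; d; x1] x2) x2N (rcons_uniq [:: c; d] x1) x1N /= inE cd.
have decE x z : valid 4 s1 z -> code x = z -> x = dec z.
  by move=> vz xz; apply: code_inj; rewrite decK.
have f0 : partial_coloring r L (fun=> 0) (coded code [::]) 0.
  split=> [v|v|e]; rewrite ?inE //.
  by rewrite (_ : [set v in coded code [::] | _] = set0) ?cards0 //; apply/setP=> x; rewrite !inE.
have [||||f [fA _ fE]] := assign_block (x0 := (0, 0)) r_sym r_irr code_inj (cs := A2) (cols := cols) f0.
- by [].
- by [].
- by [].
- move=> i x ilt xE; rewrite mem_filter; apply/andP; split.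
    by apply/mapP => -[y]; rewrite mem_enum !inE.
  by move: i ilt xE => [|[|[|[|[|[|//]]]]]] _ /= /decE ->.
rewrite cat0s in fA.
have vA z : z \in A2 -> valid 4 s1 z by apply/allP: z; vm_compute.
have SA z : z \in S2 -> valid 4 s1 z && (z \notin A2) by apply/allP: z; vm_compute.
pose av z := available r L f (coded code A2) (dec z).
have avu z : uniq (av z) by apply: available_uniq.
have av_size z n : z \in S2 -> deg adj z A2 <= n -> 6 - n <= size (av z).
  move=> /SA/andP[vz zA].
  have := available_deg L_uniq L_size code_inj code_adj f (A := A2) (x := dec z).
  by rewrite decK // => /(_ zA); rewrite -/(av z); move: (deg _ _ _) (size _); clear; lia.
have av_in z y : y \in L (dec z) -> z \in S2 ->
    (forall i, i < 6 -> adj z (nth (0, 0) A2 i) -> nth 0 cols i != y) -> y \in av z.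
  move=> yL /SA/andP[vz zA] H; rewrite mem_filter yL andbT; apply/mapP => -[x].
  rewrite mem_enum inE => /andP[]; rewrite inE => xA rzx yE.
  have i6 : index (code x) A2 < size A2 by rewrite index_mem.
  have xE : code x = nth (0, 0) A2 (index (code x) A2) by rewrite nth_index.
  have := H _ i6; rewrite -xE => H'; move: (code_adj rzx); rewrite decK // => /H'.
  by rewrite -(fE _ x i6 xE) yE eqxx.
have av_not z i : z \in S2 -> i < 6 -> adj z (nth (0, 0) A2 i) -> nth 0 cols i \notin av z.
  move=> /SA/andP[vz zA] i6 zi; have iA : nth (0, 0) A2 i \in A2 by apply: mem_nth.
  have kn := decK (vA _ iA); have kz := decK vz.
  apply/negP => /available_notin; move/(_ (dec (nth (0, 0) A2 i))).
  rewrite inE kn iA (fE i) // eqxx => /(_ isT) H; suff /H : r (dec z) (dec (nth (0, 0) A2 i)) by [].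
  by apply: r_adj; rewrite kn kz //; apply: contraNneq zA => ->.
have cb : c \in av (4, 0).
  apply: av_in => // i i6 zi; rewrite -[c]/(nth 0 cols 0) nth_uniq //.
  by apply: contraTneq zi => ->; vm_compute.
have db : d \in av (4, 1).
  apply: av_in => // i i6 zi; rewrite -[d]/(nth 0 cols 1) nth_uniq //.
  by apply: contraTneq zi => ->; vm_compute.
have [y1 y1L y1N] := @fresh_color (av (1, 1)) [:: c; d] (avu _) (av_size (1, 1) 3 isT isT).
have [y2 y2L y2N] := @fresh_color (av (1, 3)) [:: d; y1] (avu _) (av_size (1, 3) 3 isT isT).
have [y3 y3L y3N] := @fresh_color (av (2, 2)) [:: y1; y2] (avu _)
  (leq_trans (isT : 2 < 4) (av_size (2, 2) 2 isT isT)).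
have [y4 y4L y4N] := @fresh_color (av (1, 2)) [:: c; d; y1; y2; y3] (avu _)
  (av_size (1, 2) 0 isT isT).
(* [c] on [(2, 3)] and [d] on [(2, 1)] already block their neighbours, so reusing these colours
   costs such a neighbour nothing more. This needs [r_adj]: the adjacencies of the model must really
   occur. *)
have y2c : y2 != c by apply: contraTneq y2L => ->; apply: (av_not (1, 3) 0).
have y3c : y3 != c by apply: contraTneq y3L => ->; apply: (av_not (2, 2) 0).
have y3d : y3 != d by apply: contraTneq y3L => ->; apply: (av_not (2, 2) 1).
have [||||f' [f'P _ _]] := assign_block (x0 := (0, 0)) r_sym r_irr code_inj (cs := S2)
  (cols := [:: c; d; y1; y2; y3; y4]) fA; last by exists f'.
- by [].
- rewrite (rcons_uniq [:: c; d; y1; y2; y3] y4) y4N (rcons_uniq [:: c; d; y1; y2] y3).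
  rewrite !inE !(negb_or) in y2N y3N *.
  rewrite y3c y3d y3N (rcons_uniq [:: c; d; y1] y2) !inE !negb_or y2c y2N.
  by rewrite (rcons_uniq [:: c; d] y1) y1N /= inE cd.
- by [].
move=> i x ilt xE; have -> : x = dec (nth (0, 0) S2 i).
  have nS : nth (0, 0) S2 i \in S2 by exact: mem_nth.
  by apply: code_inj; rewrite xE decK //; case/andP: (SA _ nS).
by move: i ilt {xE} => [|[|[|[|[|[|//]]]]]] _ /=.
Qed.

(** If the lists of u and [(2, 3)], or those of w and [(2, 1)], share at most one colour,
    [special_plain] applies. Otherwise each pair shares two, so distinct [c] and [d] can be chosen
    for [special_matched]. *)
Lemma special_colorable :
  exists2 O, forall c, valid 4 s1 c -> c \in O & colorable r L code O 2.
Proof.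
have few x y : size [seq c <- L x | c \in L y] <= 1 ->
    forall c c', c \in L x -> c \in L y -> c' \in L x -> c' \in L y -> c = c'.
  case E: [seq c <- L x | c \in L y] => [|e [|//]] _ c c' cx cy c'x c'y.
    by have : c \in [::] by rewrite -E mem_filter cx cy.
  have : c \in [:: e] by rewrite -E mem_filter cx cy.
  have : c' \in [:: e] by rewrite -E mem_filter c'x c'y.
  by rewrite !inE => /eqP-> /eqP->.
have cover O : all (fun c => c \in O) ([:: (4, 0); (4, 1); (0, 1)] ++
    [seq (i, q) | i <- [:: 1; 2; 3], q <- [:: 1; 2; 3]]) ->
    forall c, valid 4 s1 c -> c \in O.
  move=> /allP H [i q] v; apply: H; move: v.
  by case: i => [|[|[|[|[|i]]]]]; case: q => [|[|[|[|q]]]].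
have [I1|I1] := leqP (size [seq c <- L (dec (4, 0)) | c \in L (dec (2, 3))]) 1.
  exists (first_block false 2 ++ second_block false 2); first by apply: cover; vm_compute.
  by apply: special_plain => //; apply: few.
have [I2|I2] := leqP (size [seq c <- L (dec (4, 1)) | c \in L (dec (2, 1))]) 1.
  exists (first_block true 2 ++ second_block true 2); first by apply: cover; vm_compute.
  by apply: special_plain => //; apply: few.
have [d dI _] := fresh_color (forb := [::]) (filter_uniq _ (L_uniq _)) (ltnW I2).
have [c cI cN] := fresh_color (forb := [:: d]) (filter_uniq _ (L_uniq _)) I1.
exists (A2 ++ S2); first by apply: cover; vm_compute.
move: dI cI cN; rewrite !mem_filter inE => /andP[dA dW] /andP[cB cU] cd.
exact: (special_matched cd).
Qed.

End SpecialFour.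

(** * One or two paths *)

Section Bands.
Variables (adj : rel nat) (n k : nat) (wrap : bool).
Hypotheses (k3 : 3 <= k) (wk : wrap -> 5 <= k).
Hypothesis band : forall i j, j < i < n -> adj i j ->
  (i - j <= 2) || wrap && (n - 2 <= i - j).

(** The witnesses are [c + 2], with no earlier neighbour, and [c + 1], with at most [c - 1]. When
    the block closes a cycle its final two positions also meet 0 and 1, and [k >= 5] keeps the
    witnesses away from these. *)
Lemma band_admissible c : c + k <= n -> [|| c + k == n, c + k + 5 <= n | ~~ wrap] ->
  admissible adj k (iota 0 c) (iota c k).
Proof.
move=> ckn cw; apply: (@admissible_low _ _ _ _ _ [::]) => //.
- exact: iota_uniq.
- by rewrite size_iota.
- move=> i; rewrite mem_iota => ic /=.
  have [ic2|ci2] := ltnP i (c + 2).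
    apply: (@deg_le _ _ _ _ [:: i - 1; i - 2]) => j; rewrite mem_iota => jc ij _.
    have := @band i j ltac:(lia) ij; rewrite !inE.
    by case: (wrap) wk cw => [/(_ isT)|_] /=; lia.
  apply: (@deg_le _ _ _ _ [:: 0; 1]) => j; rewrite mem_iota => jc ij _.
  have := @band i j ltac:(lia) ij; rewrite !inE.
  by case: (wrap) wk cw => [/(_ isT)|_] /=; lia.
right; exists (c + 2), (c + 1); rewrite !mem_iota; split; try lia.
- apply: deg_eq0 => j; rewrite mem_iota => jc ij.
  have := @band (c + 2) j ltac:(lia) ij.
  by case: (wrap) wk cw => [/(_ isT)|_] /=; lia.
- apply: (@deg_le _ _ _ _ [:: c - 1]) => j; rewrite mem_iota => jc ij _.
  have := @band (c + 1) j ltac:(lia) ij; rewrite !inE.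
  by case: (wrap) wk cw => [/(_ isT)|_] /=; lia.
Qed.

Lemma band_layered N : 0 < N <= n -> [|| N == n, N + 5 <= n | ~~ wrap] ->
  layered adj k (iota 0 N) (ceil_div N k).
Proof.
elim/ltn_ind: N => N IH /andP[N0 Nn] Nw.
have [Nk|kN] := leqP N k.
  by rewrite ceil_div_small //; apply: layered_small; rewrite size_iota.
rewrite (@ceil_div_step N (N - k) k) //; try lia.
rewrite -{1}(subnK (ltnW kN)) iotaD; apply: LayeredS.
  by apply: IH; try lia; case: (wrap) wk Nw => [/(_ isT)|_] /=; lia.
by apply: band_admissible; rewrite subnK // ltnW.
Qed.

End Bands.

Lemma layered_colorable (C : eqType) (adj : rel C) (T : finType) (r : rel T)
    (L : T -> seq nat) (k : nat) (code : T -> C) A q :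
  symmetric r -> (forall x, ~~ r x x) -> (forall v, uniq (L v)) ->
  (forall v, size (L v) = k) -> injective code ->
  (forall x y, r x y -> adj (code x) (code y)) ->
  layered adj k A q -> colorable r L code A q.
Proof.
move=> rs ri Lu Ls ci ca; elim=> [|{}A S {}q _ IH adm]; first exact: colorable_nil.
exact: (@colorable_cat _ adj _ _ _ k).
Qed.

(** * Squares of even cycles with lists of size 4 *)

Section Cycles.
Variables (T : finType) (r : rel T) (L : T -> seq nat) (n : nat).
Hypotheses (r_sym : symmetric r) (r_irr : forall x, ~~ r x x).
Hypotheses (L_uniq : forall v, uniq (L v)) (n6 : 6 <= n) (n_even : ~~ odd n).

Definition near (i j : nat) := (0 < (i - j) + (j - i) <= 2) || (n - 2 <= (i - j) + (j - i)).

Definition cyclic_code (code : T -> nat) (dec : nat -> T) :=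
  [/\ injective code, forall x, code x < n, forall i, i < n -> code (dec i) = i &
      forall x y, r x y -> near (code x) (code y)].

Lemma rotate_code code dec d : d < n -> cyclic_code code dec ->
  exists code' dec', cyclic_code code' dec' /\
    forall i, i < n -> dec' i = dec (if i + d < n then i + d else i + d - n).
Proof.
move=> dn [inj lt decK adj].
exists (fun x => if code x < d then code x + n - d else code x - d).
exists (fun i => dec (if i + d < n then i + d else i + d - n)); split=> //; split.
- move=> x y E; apply: inj; move: E (lt x) (lt y).
  by case: (ltnP (code x) d); case: (ltnP (code y) d); lia.
- by move=> x; have := lt x; case: ifP; lia.
- move=> i ilt; rewrite decK; first by case: ifP; case: ifP; lia.
  by case: ifP; lia.
- move=> x y /adj; have := lt x; have := lt y; rewrite /near.
  by case: (ltnP (code x) d); case: (ltnP (code y) d); lia.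
Qed.

Hypothesis L_size : forall v, size (L v) = 4.
Variables (code : T -> nat) (dec : nat -> T).
Hypothesis codeP : cyclic_code code dec.

Let code_inj : injective code. Proof. by case: codeP. Qed.
Let code_lt x : code x < n. Proof. by case: codeP. Qed.
Let decK i : i < n -> code (dec i) = i. Proof. by case: codeP => _ _ /(_ i). Qed.
Let code_near x y : r x y -> near (code x) (code y). Proof. by case: codeP => _ _ _; apply. Qed.

(** The first [n - 4] positions never wrap around, so the linear argument covers them even for
    [k = 4]; only the last block of four meets the closure of the cycle. *)
Let near_band i j : j < i < n - 4 -> near i j -> (i - j <= 2) || false && (n - 4 - 2 <= i - j).
Proof. by rewrite /near; lia. Qed.

Lemma cycle_prefix a r0 j : a \in L (dec 0) -> 0 < r0 <= 4 -> r0 + 4 * j <= n - 4 ->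
  exists2 f, partial_coloring r L f (coded code (iota 0 (r0 + 4 * j))) j.+1 & f (dec 0) = a.
Proof.
move=> aL r04; elim: j => [|j IH] jn; last first.
  have [|f fP fa] := IH; first by lia.
  have adm : admissible near 4 (iota 0 (r0 + 4 * j)) (iota (r0 + 4 * j) 4).
    by apply: (@band_admissible near (n - 4) 4 false _ _ near_band); rewrite ?orbT //; lia.
  have [f' f'P f'f] := extend_coded r_sym r_irr L_uniq L_size code_inj code_near fP adm.
  exists f'.
    suff -> : iota 0 (r0 + 4 * j.+1) = iota 0 (r0 + 4 * j) ++ iota (r0 + 4 * j) 4 by [].
    by rewrite -[in X in _ ++ X](add0n (r0 + 4 * j)) -iotaD; congr iota; lia.
  by rewrite f'f // inE decK ?mem_iota; lia.
have [x1 x1L x1N] := @fresh_color (L (dec 1)) [:: a] (L_uniq _) ltac:(by rewrite L_size).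
have [x2 x2L x2N] := @fresh_color (L (dec 2)) [:: a; x1] (L_uniq _) ltac:(by rewrite L_size).
have [x3 x3L x3N] := @fresh_color (L (dec 3)) [:: a; x1; x2] (L_uniq _) ltac:(by rewrite L_size).
have f0 : partial_coloring r L (fun=> 0) (coded code [::]) 0.
  split=> [v|v|e]; rewrite ?inE //.
  by rewrite (_ : [set v in coded code [::] | _] = set0) ?cards0 //; apply/setP=> x; rewrite !inE.
have [||||f [fP _ fE]] := assign_block (x0 := 0) r_sym r_irr code_inj (cs := iota 0 (r0 + 4 * 0))
  (cols := take r0 [:: a; x1; x2; x3]) f0.
- by rewrite iota_uniq.
- apply: take_uniq; rewrite (rcons_uniq [:: a; x1; x2] x3) x3N (rcons_uniq [:: a; x1] x2) x2N.
  by rewrite (rcons_uniq [:: a] x1) x1N.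
- by rewrite size_iota size_takel //=; lia.
- move=> i x; rewrite size_iota => ilt; rewrite nth_iota // add0n => xE.
  have -> : x = dec i by apply: code_inj; rewrite decK //; lia.
  rewrite mem_filter; apply/andP; split.
    by apply/mapP => -[y]; rewrite mem_enum !inE.
  rewrite nth_take; last by lia.
  have i4 : i < 4 by lia.
  by case: i i4 {ilt xE} => [|[|[|[|]]]].
exists f => //; rewrite (fE 0) ?size_iota ?nth_iota ?nth_take ?decK //; lia.
Qed.

Lemma cycle_split : exists r0 q, [/\ 0 < r0 <= 4, n - 4 = r0 + 4 * q & ceil_div n 4 = q.+2].
Proof.
(* As [n] is even, [n %% 4] is 0 or 2. The first block takes the remainder, with 4 instead of 0 so
   that it contains [dec 0]. *)
exists (if n %% 4 == 0 then 4 else 2), ((n - 5) %/ 4); rewrite /ceil_div /=.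
by case: (n %% 4 =P 0) => E; split; lia.
Qed.

Lemma iota_last : iota 0 n = iota 0 (n - 4) ++ iota (n - 4) 4.
Proof. by rewrite -[in X in _ ++ X](add0n (n - 4)) -iotaD; congr iota; lia. Qed.

Lemma card_back f A B x : (forall y, code y \in A -> r x y -> f y \in L x -> code y \in B) ->
  #|[set y in coded code A | r x y & f y \in L x]| <= size B.
Proof.
move=> H; apply: leq_trans (card_coded code_inj B); apply/subset_leq_card/subsetP => y.
by rewrite !inE => /and3P[]; apply: H.
Qed.

(* As [dec 0] gets a colour that is not in the list of its neighbour [dec (n - 2)], the
   latter loses no colour to the previous blocks. *)
Lemma cycle_distinct a : a \in L (dec 0) -> a \notin L (dec (n - 2)) ->
  colorable r L code (iota 0 n) (ceil_div n 4).
Proof.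
move=> a0 an; have [r0 [q [r04 nq ->]]] := cycle_split.
have [|f fP fa] := cycle_prefix (j := q) a0 r04; first by lia.
rewrite iota_last; rewrite -nq in fP.
(* In order, the last four vertices lose at most 2, 1, 0 and 2 colours. Without the assumption on
   [a], the third could lose one to [dec 0] and none would be free. *)
pose bnd i := if i == n - 1 then 2 else if i == n - 2 then 0 else if i == n - 3 then 1 else 2.
have bndP x : code x \in iota (n - 4) 4 ->
    #|[set y in coded code (iota 0 (n - 4)) | r x y & f y \in L x]| <= bnd (code x).
  rewrite mem_iota => xn; rewrite /bnd; case: eqP => [x1|x1].
    apply: (@card_back _ _ [:: 0; 1]) => y; rewrite mem_iota !inE => yn /code_near.
    by rewrite /near; lia.
  case: eqP => [x2|x2].
    apply: (@card_back _ _ [::]) => y; rewrite mem_iota => yn /code_near near_xy fy.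
    have y0 : code y = code (dec 0) by rewrite decK; move: near_xy; rewrite /near; lia.
    move: fy; rewrite (code_inj y0) fa (_ : x = dec (n - 2)) ?(negbTE an) //.
    by apply: code_inj; rewrite decK //; lia.
  case: eqP => [x3|x3].
    apply: (@card_back _ _ [:: n - 5]) => y; rewrite mem_iota !inE => yn /code_near.
    by rewrite /near; lia.
  apply: (@card_back _ _ [:: n - 5; n - 6]) => y; rewrite mem_iota !inE => yn /code_near.
  by rewrite /near; lia.
have [t tk|f' f'P _] := extend_block r_sym L_uniq L_size r_irr fP
    (coded_disjoint code (iota 0 (n - 4)) (iota (n - 4) 4)); last first.
  by exists f'; rewrite coded_cat.
apply: (@leq_trans (count (fun i => t <= bnd i) (iota (n - 4) 4))).
  apply: leq_trans (card_filter_coded code_inj _ _); apply/subset_leq_card/subsetP => x.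
  rewrite inE => /andP[]; rewrite inE => /andP[xS _] tx; rewrite inE xS.
  exact: leq_trans tx (bndP x xS).
have -> : iota (n - 4) 4 = [:: n - 4; n - 3; n - 2; n - 1].
  by rewrite /=; congr [:: _; _; _; _]; lia.
have e1 : bnd (n - 1) = 2 by rewrite /bnd eqxx.
have e2 : bnd (n - 2) = 0 by rewrite /bnd eqxx ifN //; lia.
have e3 : bnd (n - 3) = 1 by rewrite /bnd eqxx !ifN //; lia.
have e4 : bnd (n - 4) = 2 by rewrite /bnd !ifN //; lia.
by rewrite /= e1 e2 e3 e4; case: t tk => [|[|[|[|[|t]]]]].
Qed.

(** Choose [x1], [x4], [x2] greedily. If nothing is left for [X3], it consists of exactly these
    three colours; then [X2] has a colour outside [X3], and [x2] passes to [X3]. *)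
Lemma four_representatives (X1 X2 X3 X4 : seq nat) :
  uniq X1 -> uniq X2 -> uniq X3 -> uniq X4 ->
  2 <= size X1 -> 3 <= size X2 -> 3 <= size X3 -> 2 <= size X4 ->
  size [seq c <- X2 | c \in X3] <= 2 ->
  exists x1 x2 x3 x4, uniq [:: x1; x2; x3; x4] /\
    [/\ x1 \in X1, x2 \in X2, x3 \in X3 & x4 \in X4].
Proof.
move=> u1 u2 u3 u4 s1 s2 s3 s4 s23.
have [x1 x1X _] := fresh_color (forb := [::]) u1 (ltnW s1).
have [x4 x4X x4N] := @fresh_color X4 [:: x1] u4 s4.
have [x2 x2X x2N] := @fresh_color X2 [:: x1; x4] u2 s2.
have [/hasP[x3 x3X x3N]|/hasPn sub] := boolP (has (fun c => c \notin [:: x1; x4; x2]) X3).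
  exists x1, x2, x3, x4; split=> //; move: x4N x2N x3N; rewrite /= !inE !negb_or.
  by clear; lia.
have sub' : {subset X3 <= [:: x1; x4; x2]} by move=> c /sub; rewrite negbK.
have [_ E] := uniq_min_size u3 sub' s3.
have [y yX yN] := @fresh_color X2 [seq c <- X2 | c \in X3] u2 (leq_ltn_trans s23 s2).
have yX3 : y \notin [:: x1; x4; x2].
  by rewrite -E; apply: contra yN => yX3; rewrite mem_filter yX3.
exists x1, y, x2, x4; split; last by rewrite E !inE eqxx !orbT.
by move: x4N x2N yX3; rewrite /= !inE !negb_or; clear; lia.
Qed.

(** The last four vertices keep at least 2, 3, 3 and 2 colours, and the assumption bounds the
    overlap of the middle pair as [four_representatives] requires. *)
Lemma cycle_few_common : size [seq c <- L (dec (n - 2)) | c \in L (dec (n - 3))] <= 2 ->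
  colorable r L code (iota 0 n) (ceil_div n 4).
Proof.
move=> few; set A := iota 0 (n - 4).
have [f fP] : colorable r L code A (ceil_div (n - 4) 4).
  apply: (layered_colorable r_sym r_irr L_uniq L_size code_inj code_near).
  by apply: (@band_layered near (n - 4) 4 false _ _ near_band); rewrite ?eqxx //; lia.
rewrite (@ceil_div_step n (n - 4) 4) //; [|lia|lia|lia].
pose av i := available r L f (coded code A) (dec i).
have avu i : uniq (av i) by apply: available_uniq.
have av_size i B : n - 4 <= i < n ->
    (forall j, j < n - 4 -> near i j -> j \in B) -> 4 - size B <= size (av i).
  move=> ilt H; have iA : code (dec i) \notin A by rewrite decK ?mem_iota; lia.
  have := available_deg L_uniq L_size code_inj code_near f iA; rewrite decK; last by lia.
  have : deg near i A <= size B by apply: deg_le => j; rewrite mem_iota add0n => /andP[_ /H jB] /jB.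
  by rewrite -/(av i); move: (deg _ _ _) (size _) (size _); clear; lia.
have [|||||||||x1 [x2 [x3 [x4 [ux [x1X x2X x3X x4X]]]]]] :=
  @four_representatives (av (n - 1)) (av (n - 2)) (av (n - 3)) (av (n - 4)) => //.
- by apply: (av_size _ [:: 0; 1]); [lia|move=> j; rewrite !inE /near; lia].
- by apply: (av_size _ [:: 0]); [lia|move=> j; rewrite !inE /near; lia].
- by apply: (av_size _ [:: n - 5]); [lia|move=> j; rewrite !inE /near; lia].
- by apply: (av_size _ [:: n - 5; n - 6]); [lia|move=> j; rewrite !inE /near; lia].
- apply: leq_trans few; apply: uniq_leq_size; first exact: filter_uniq.
  by move=> c; rewrite !mem_filter => /andP[/andP[_ ->] /andP[_ ->]].
have [||||f' [f'P _ _]] := assign_block (x0 := 0) r_sym r_irr code_inj (cs := iota (n - 4) 4)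
  (cols := [:: x4; x3; x2; x1]) fP; last by rewrite iota_last; exists f'.
- by rewrite -iota_last iota_uniq.
- by rewrite -rev_uniq.
- by [].
move=> i x; rewrite size_iota => ilt; rewrite nth_iota // => xE.
have -> : x = dec (n - 4 + i) by apply: code_inj; rewrite decK //; lia.
case: i ilt {xE} => [|[|[|[|//]]]] _ /=; first by rewrite addn0.
- by rewrite (_ : n - 4 + 1 = n - 3) //; lia.
- by rewrite (_ : n - 4 + 2 = n - 2) //; lia.
- by rewrite (_ : n - 4 + 3 = n - 1) //; lia.
Qed.

(* Positions are coloured 0123 0123 and so on, ending with 012 012 when 4 does
   not divide [n]; the fourth colour is used at odd positions only. *)
Let pattern i := if (n %% 4 == 0) || (i < n - 6) then i %% 4 else (i - (n - 6)) %% 3.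
(** A colour occurs once per group, so the number of groups bounds its use. When 4 does not divide
    [n], the last six positions form two groups of three, and [(n - 6) %/ 4 + 2] is still
    [ceil_div n 4]. *)
Let group i := if (n %% 4 == 0) || (i < n - 6) then i %/ 4
               else (n - 6) %/ 4 + (i - (n - 6)) %/ 3.

Lemma pattern_near i j : i < n -> j < n -> near i j -> pattern i != pattern j.
Proof.
rewrite /near /pattern => ilt jlt.
case: (n %% 4 =P 0) => [n4|n4] /=; first by lia.
have n42 : n %% 4 = 2 by lia.
by case: (ltnP i (n - 6)) => i6; case: (ltnP j (n - 6)) => j6; lia.
Qed.

Lemma group_lt i : i < n -> group i < ceil_div n 4.
Proof.
rewrite /group /ceil_div /= => ilt.
by case: (n %% 4 =P 0) => [n4|n4] /=; [|case: (ltnP i (n - 6)) => i6]; lia.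
Qed.

Lemma group_inj i j : i < n -> j < n -> pattern i = pattern j -> group i = group j -> i = j.
Proof.
rewrite /group /pattern => ilt jlt; case: (n %% 4 =P 0) => [n4|n4] /=; first by lia.
by case: (ltnP i (n - 6)) => i6; case: (ltnP j (n - 6)) => j6; lia.
Qed.

Lemma pattern_odd i : i < n -> (pattern i < 3) || (pattern i == 3) && odd i.
Proof.
rewrite /pattern => ilt; case: (n %% 4 =P 0) => [n4|n4] /=; first by lia.
by case: (ltnP i (n - 6)) => i6; lia.
Qed.

Lemma cycle_common c0 c1 c2 c3 : uniq [:: c0; c1; c2; c3] ->
  (forall x, [/\ c0 \in L x, c1 \in L x & c2 \in L x]) ->
  (forall x, odd (code x) -> c3 \in L x) ->
  colorable r L code (iota 0 n) (ceil_div n 4).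
Proof.
move=> uc cL c3L; pose f x := nth 0 [:: c0; c1; c2; c3] (pattern (code x)).
have p4 x : pattern (code x) < 4 by have := pattern_odd (code_lt x); lia.
exists f; split.
- move=> x _; have [L0 L1 L2] := cL x; have := pattern_odd (code_lt x); rewrite /f.
  by case: (pattern (code x)) => [|[|[|[|p]]]] //= /c3L.
- by move=> x y _ _ /code_near xy; rewrite /f nth_uniq //; apply: pattern_near.
- move=> c; rewrite -(size_iota 0 (ceil_div n 4)) cardE -(size_map (group \o code)).
  apply: uniq_leq_size; last first.
    by move=> g /mapP[x _ ->]; rewrite mem_iota /= group_lt.
  rewrite map_inj_in_uniq ?enum_uniq // => x y; rewrite !mem_enum !inE /f.
  move=> /andP[_ /eqP <-] /andP[_ fxy] /= gxy; apply: code_inj; apply: group_inj => //.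
  by move: fxy; rewrite nth_uniq // => /eqP.
Qed.

End Cycles.

(* Unless [cycle_distinct] applies at some rotation of the cycle, all vertices of the
   same parity have the same list. *)
Lemma cycle_four_choosable (T : finType) (r : rel T) (L : T -> seq nat) n code dec :
  symmetric r -> (forall x, ~~ r x x) -> (forall v, uniq (L v)) -> 6 <= n -> ~~ odd n ->
  (forall v, size (L v) = 4) -> cyclic_code r n code dec ->
  exists2 code' : T -> nat, forall x, code' x < n &
    colorable r L code' (iota 0 n) (ceil_div n 4).
Proof.
move=> rs ri Lu n6 n_even Ls codeP; have [inj lt decK adj] := codeP.
pose back i := if i < 2 then i + n - 2 else i - 2.
have [/forallP H|] := boolP [forall i : 'I_n, all (fun a => a \in L (dec (back i))) (L (dec i))];
  last first.
  rewrite negb_forall => /existsP[[i ilt]] /= /allPn[a aL aN].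
  have [code' [dec' [codeP' decE]]] := rotate_code n6 n_even ilt codeP.
  exists code'; first by case: codeP'.
  apply: (cycle_distinct rs ri Lu n6 n_even Ls codeP' (a := a)).
    by rewrite decE ?ilt //; lia.
  rewrite decE; last by lia.
  by move: aN; rewrite /back; case: ifP => i2; case: ifP => n2; try lia;
    congr (~~ (_ \in L (dec _))); lia.
have step i a : i < n -> a \in L (dec i) -> a \in L (dec (back i)).
  by move=> ilt; have /allP := H (Ordinal ilt); apply.
have down i j a : 2 * j <= i -> i < n -> a \in L (dec i) -> a \in L (dec (i - 2 * j)).
  elim: j => [|j IH] ji ilt aL; first by rewrite subn0.
  have <- : back (i - 2 * j) = i - 2 * j.+1.
    rewrite /back; case: ltnP => ij; clear -ji ij; lia.
  by apply: step; [clear -ilt; lia|apply: IH => //; clear -ji; lia].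
have evenL a : a \in L (dec (n - 2)) -> forall x, ~~ odd (code x) -> a \in L x.
  move=> aL x ev; have -> : x = dec (n - 2 - 2 * ((n - 2 - code x)./2)).
    by apply: inj; rewrite decK; have := lt x; lia.
  by apply: down => //; lia.
have oddL a : a \in L (dec (n - 3)) -> forall x, odd (code x) -> a \in L x.
  (* Position [n - 1] lies beyond [n - 3], so it is reached around the cycle, from position 1. *)
  move=> aL x od; have [xn|xn] := eqVneq (code x) (n - 1).
    have -> : x = dec (back 1) by apply: inj; rewrite decK /back /=; have := lt x; lia.
    apply: step; first by lia.
    by rewrite (_ : 1 = n - 3 - 2 * (n - 4)./2); [apply: down => //; lia|lia].
  have -> : x = dec (n - 3 - 2 * ((n - 3 - code x)./2)).
    by apply: inj; rewrite decK; have := lt x; lia.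
  by apply: down => //; have := lt x; lia.
exists code; first exact: lt.
have [few|many] := leqP (size [seq c <- L (dec (n - 2)) | c \in L (dec (n - 3))]) 2.
  exact: (cycle_few_common rs ri Lu n6 n_even Ls codeP few).
(* Three common colours lie in every list, by [evenL] and [oddL]; a fourth colour from
   [L (dec (n - 3))], which lies in all lists at odd positions, will serve as [c3]. *)
case E: [seq c <- L (dec (n - 2)) | c \in L (dec (n - 3))] many => [//|c0 [//|c1 [//|c2 l]]] _.
have uc : uniq [:: c0, c1, c2 & l] by rewrite -E filter_uniq.
have inL c : c \in [:: c0, c1, c2 & l] -> forall x, c \in L x.
  rewrite -E mem_filter => /andP[c3 c2'] x.
  by case xo: (odd (code x)); [apply: oddL|apply: evenL; rewrite ?xo].
have u3 : uniq [:: c0; c1; c2] by apply: (subseq_uniq _ uc); apply: (prefix_subseq [:: c0; c1; c2] l).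
have [c3 c3L c3N] := @fresh_color (L (dec (n - 3))) [:: c0; c1; c2] (Lu _) ltac:(by rewrite Ls).
apply: (cycle_common n6 n_even codeP (c0 := c0) (c1 := c1) (c2 := c2) (c3 := c3)).
- by rewrite (rcons_uniq [:: c0; c1; c2] c3) c3N.
- by move=> x; split; apply: inL; rewrite !inE eqxx ?orbT.
- exact: oddL.
Qed.

(** * Positions along a path or a cycle *)

Section FewPaths.
Variables (m : nat) (s : nat -> nat).
Hypothesis s0 : 0 < s 0.
Let n := s 0 + 2 + (if m == 2 then s 1 else 0).

(** Goes round the cycle: u at 0, path 0 upwards, w at [s 0 + 1], then path 1 backwards to u. For
    [m = 1] it enumerates the single path. *)
Definition place (c : node) :=
  if c.1 == m then (if c.2 == 0 then 0 else s 0 + 1)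
  else if c.1 == 0 then c.2 else n - c.2.

Lemma place_pos0 q : 0 < m -> place (pos m s 0 q) = minn q (s 0 + 1).
Proof.
rewrite /place /pos => m0; case: (q =P 0) => [->|q0] /=; first by rewrite eqxx min0n.
case: (leqP q (s 0)) => qs /=; last by rewrite eqxx; lia.
by rewrite ifN /=; lia.
Qed.

Lemma place_pos1 q : m = 2 -> place (pos m s 1 q) = if q == 0 then 0 else n - minn q (s 1 + 1).
Proof.
rewrite /place /pos /n => m2; case: (q =P 0) => [_|q0] /=; first by rewrite eqxx.
rewrite m2 /=; case: (leqP q (s 1)) => qs /=; lia.
Qed.

Lemma place_near c y : m = 2 -> 3 <= s 1 -> valid m s c -> cadj m s c y -> y != c ->
  near n (place c) (place y).
Proof.
move=> m2 s1; have nE : n = s 0 + 2 + s 1 by rewrite /n m2.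
have m0 : 0 < m by lia.
have place0 p : place (0, p) = p by rewrite /place m2.
have place1 p : place (1, p) = n - p by rewrite /place m2.
have placeU : place (m, 0) = 0 by rewrite /place eqxx.
have placeW : place (m, 1) = s 0 + 1 by rewrite /place eqxx.
have iota2 : iota 0 m = [:: 0; 1] by rewrite m2.
case: c => i p; rewrite /valid /= => /orP[/andP[/eqP-> p1]|/and3P[im p0 ps]].
  have /orP[/eqP->|/eqP->] : (p == 0) || (p == 1) by lia.
    rewrite cadj_source iota2 /= !inE placeU => /orP[]/orP[]/eqP-> _;
    by rewrite ?place_pos0 ?place_pos1 //= /near; try (case: eqP => ?); lia.
  rewrite cadj_sink iota2 /= !inE placeW => /orP[]/orP[]/eqP-> _;
  by rewrite ?place_pos0 ?place_pos1 //= /near; try (case: eqP => ?); lia.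
rewrite cadj_path // iota2 /= !inE.
have /orP[/eqP iE|/eqP iE] : (i == 0) || (i == 1) by lia.
  rewrite iE in ps *; rewrite place0 => /or3P[/or4P[]|/andP[/eqP pE]|/andP[/eqP pE]].
  - 1,2,3,4: by move=> /eqP-> _; rewrite place_pos0 // /near; lia.
  - by case/orP => /eqP->; rewrite ?place1 xpair_eqE /= /near; lia.
  - by case/orP => /eqP->; rewrite ?place1 xpair_eqE /= /near; lia.
rewrite iE in ps *; rewrite place1 => /or3P[/or4P[]|/andP[/eqP pE]|/andP[/eqP pE]].
- 1,2,3,4: by move=> /eqP-> _; rewrite place_pos1 // /near; case: eqP => ?; lia.
- by case/orP => /eqP->; rewrite ?place0 xpair_eqE /= /near; lia.
- by case/orP => /eqP->; rewrite ?place0 xpair_eqE /= /near; lia.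
Qed.

Lemma place_band c y : m = 1 -> valid m s c -> cadj m s c y ->
  (place c - place y) + (place y - place c) <= 2.
Proof.
move=> m1; have m0 : 0 < m by lia.
have place0 p : place (0, p) = p by rewrite /place m1.
have placeU : place (m, 0) = 0 by rewrite /place eqxx.
have placeW : place (m, 1) = s 0 + 1 by rewrite /place eqxx.
have iota1 : iota 0 m = [:: 0] by rewrite m1.
case: c => i p; rewrite /valid /= => /orP[/andP[/eqP-> p1]|/and3P[im p0 ps]].
  have /orP[/eqP->|/eqP->] : (p == 0) || (p == 1) by lia.
    by rewrite cadj_source iota1 /= !inE placeU => /orP[]/eqP->; rewrite place_pos0 //; lia.
  by rewrite cadj_sink iota1 /= !inE placeW => /orP[]/eqP->; rewrite place_pos0 //; lia.
have i0 : i = 0 by lia.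
rewrite cadj_path // iota1 /= !inE i0 in ps *.
rewrite place0 => /or3P[/or4P[]|/andP[/eqP pE /eqP->]|/andP[/eqP pE /eqP->]].
- 1,2,3,4: by move=> /eqP->; rewrite place_pos0 //; lia.
- by rewrite place0; lia.
- by rewrite place0; lia.
Qed.

Lemma place_lt c : m <= 2 -> valid m s c -> place c < n.
Proof.
rewrite /place /n /valid; case: c => i p; case: (m) => [|[|[|//]]] _;
  by case: i => [|[|[|i]]] //=; try case: (p =P 0); lia.
Qed.

Lemma place_inj c d : m <= 2 -> valid m s c -> valid m s d -> place c = place d -> c = d.
Proof.
rewrite /place /n /valid; case: c => i p; case: d => j q; case: (m) => [|[|[|//]]] _;
  case: i => [|[|[|i]]] //=; case: j => [|[|[|j]]] //=;
  by case: (p =P 0) => ?; case: (q =P 0) => ? *; congr pair; lia.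
Qed.

Definition unplace j : node :=
  if j == 0 then (m, 0) else if j <= s 0 then (0, j) else if j == s 0 + 1 then (m, 1)
  else (1, n - j).

Lemma unplaceP j : 0 < m <= 2 -> j < n -> valid m s (unplace j) /\ place (unplace j) = j.
Proof.
rewrite /unplace => m2 jn.
case: (j =P 0) => [->|j0]; first by rewrite /place /valid /= eqxx.
move: m2 jn; rewrite /place /valid /n; case: (m) => [|[|[|//]]] //= _ jn;
  by case: (leqP j (s 0)) => js /=; [|case: (j =P s 0 + 1) => js' /=]; split; lia.
Qed.

End FewPaths.

Lemma eq_cadj m s s' c y : (forall i, i < m -> s i = s' i) -> valid m s c ->
  cadj m s c y = cadj m s' c y.
Proof.
move=> ss'; have pE i p : i < m -> pos m s i p = pos m s' i p by move=> im; rewrite /pos ss'.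
have mapE (F F' : nat -> nat * nat) : (forall i, i < m -> F i = F' i) ->
    [seq F j | j <- iota 0 m] = [seq F' j | j <- iota 0 m].
  by move=> FF; apply/eq_in_map => i; rewrite mem_iota => im; apply: FF; lia.
rewrite /cadj => vc; suff -> : nbrs m s c = nbrs m s' c by [].
move: vc; rewrite /valid /nbrs /path_nbrs; case: eqP => [_ _|_ /= /andP[cm _]].
  by case: ifP => _; congr (_ ++ _); apply: mapE => i im; rewrite ?ss' ?pE.
rewrite !pE // ss' //; do 4 congr cons; congr cat.
by case: ifP => // _; apply: mapE => i im; rewrite ss'.
Qed.

(** * Assembling the cases *)

Section ModelTheorem.
Variables (T : finType) (r : rel T) (L : T -> seq nat) (m k : nat) (s : nat -> nat).
Variables (code : T -> nat * nat) (dec : nat * nat -> T).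
Hypotheses (r_sym : symmetric r) (r_irr : forall x, ~~ r x x).
Hypotheses (L_uniq : forall v, uniq (L v)) (L_size : forall v, size (L v) = k).
Hypotheses (code_inj : injective code) (code_valid : forall x, valid m s (code x)).
Hypothesis decK : forall c, valid m s c -> code (dec c) = c.
Hypothesis code_adj : forall x y, r x y -> cadj m s (code x) (code y).
Hypotheses (mk : m + 2 <= k) (s_pos : forall i, i < m -> 0 < s i).
Hypotheses (s_odd : forall i, i < m -> odd (s i)).
Hypotheses (s_sorted : forall i j, i <= j < m -> s i <= s j).
Hypothesis s_3 : 1 < m -> 3 <= s 1.

Let conclusion := exists f, [/\ forall v, f v \in L v, forall x y, r x y -> f x != f y &
  forall c, #|[pred v | f v == c]| <= ceil_div #|T| k].

Lemma finish (C : eqType) (code' : T -> C) O q : (forall x, code' x \in O) ->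
  colorable r L code' O q -> q <= ceil_div #|T| k -> conclusion.
Proof.
move=> inO col qT; have [f [f1 f2 f3]] := colorable_total inO col.
by exists f; split=> // c; apply: leq_trans (f3 c) qT.
Qed.

(** Lower bounds on [#|T|] suffice: the number of blocks has only to stay below [ceil_div #|T| k],
    which is monotone in [#|T|]. *)
Lemma size_le_card O : uniq O -> {in O, forall c, valid m s c} -> size O <= #|T|.
Proof.
move=> uO vO; rewrite cardE -(size_map code); apply: uniq_leq_size => // c cO.
by apply/mapP; exists (dec c); rewrite ?mem_enum // decK // vO.
Qed.

Lemma ceil_div_mono a b : a <= b -> ceil_div a k <= ceil_div b k.
Proof. by move=> ab; rewrite leq_div2r // leq_add2r. Qed.

Lemma finish_layered O q : (forall c, valid m s c -> c \in O) ->
  layered (cadj m s) k O q -> q <= ceil_div #|T| k -> conclusion.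
Proof.
move=> vO lay; apply: (@finish _ code O) => [x|]; first exact: vO.
exact: (layered_colorable r_sym r_irr L_uniq L_size code_inj code_adj lay).
Qed.

Lemma ceil_div_gt a q : 0 < k -> q * k < a -> q < ceil_div a k.
Proof. by move=> k0 qa; rewrite /ceil_div leq_divRL // mulSn; lia. Qed.

Lemma finish_small : #|T| <= k -> conclusion.
Proof.
move=> Tk; pose O := [seq code x | x <- enum T].
have vO c : valid m s c -> c \in O.
  by move=> /decK <-; apply: map_f; rewrite mem_enum.
apply: (finish_layered (q := 1) vO); first by apply: layered_small; rewrite size_map -cardE.
apply: ceil_div_gt; first by lia.
rewrite mul0n; apply: leq_trans (_ : size [:: (m, 0)] <= _) => //.
by apply: size_le_card => // c; rewrite inE => /eqP->; rewrite /valid eqxx.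
Qed.

Lemma s_ge3 i : 0 < i < m -> 3 <= s i.
Proof. by move=> im; apply: leq_trans (s_3 _) (s_sorted _); lia. Qed.

Lemma conclusion_long : 3 <= m -> 5 <= s m.-1 -> conclusion.
Proof.
move=> m3 s5.
(* [a] counts the paths before [b] with [s i <= 3]. The sizes are sorted and odd, so the later ones
   are at least 5. *)
have split_at b : b <= m.-1 -> exists a, [/\ a <= b, forall i, i < a -> s i <= 3 &
    forall i, a <= i < b -> 5 <= s i].
  elim: b => [|b IH] bm; first by exists 0; split=> // i; lia.
  have [a [ab Ha Hb]] := IH (ltnW bm).
  have [bs|bs] := leqP (s b) 3; last first.
    exists a; split=> // [|i]; first by lia.
    rewrite leq_eqVlt; have [->|ib] := eqVneq i b; first by have := @s_odd b; lia.
    by move=> ai; apply: Hb; lia.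
  have abE : a = b.
    by apply/eqP; rewrite eqn_leq ab leqNgt; apply/negP => ab'; have := Hb a ltac:(lia);
    have := @s_sorted a b ltac:(lia); lia.
  by exists b.+1; split=> // i; [rewrite ltnS => ib; apply: leq_trans bs; apply: s_sorted; lia|lia].
have [a [am short_a long_a]] := split_at _ (leqnn _).
have [O [uO OE lay]] := long_order m3 mk (s_pos (ltac:(lia) : 0 < m)) s_ge3 s5 s_odd am short_a long_a.
apply: (finish_layered (O := O) _ lay) => [c|]; first by rewrite OE.
by apply: ceil_div_mono; apply: size_le_card => // c; rewrite OE.
Qed.

Let n := s 0 + 2 + (if m == 2 then s 1 else 0).
Let spot x := place m s (code x).
Let unspot j := dec (unplace m s j).

Lemma spotK j : 0 < m <= 2 -> j < n -> spot (unspot j) = j.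
Proof.
move=> m2 jn; have s0 : 0 < s 0 by apply: s_pos; case/andP: m2.
by have [vj pj] := unplaceP s0 m2 jn; rewrite /spot /unspot decK.
Qed.

Lemma spot_lt x : 0 < m <= 2 -> spot x < n.
Proof. by case/andP=> m0 m2; apply: place_lt; first exact: s_pos. Qed.

Lemma spot_inj : 0 < m <= 2 -> injective spot.
Proof.
by case/andP=> m0 m2 x y xy; apply: code_inj; apply: (place_inj (s_pos m0) m2).
Qed.

Lemma n_le_card : 0 < m <= 2 -> n <= #|T|.
Proof.
move=> m2; rewrite -(size_iota 0 n) cardE -(size_map spot).
apply: uniq_leq_size; first exact: iota_uniq.
move=> j; rewrite mem_iota => /andP[_ jn].
by apply/mapP; exists (unspot j); rewrite ?mem_enum ?spotK.
Qed.

Lemma conclusion_one : m = 1 -> conclusion.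
Proof.
move=> m1; have m2 : 0 < m <= 2 by rewrite m1.
pose adj i j := (i - j) + (j - i) <= 2.
have lay : layered adj k (iota 0 n) (ceil_div n k).
  apply: (@band_layered adj n k false); rewrite ?eqxx ?leqnn ?andbT //; first by lia.
  - by move=> i j; rewrite /adj; lia.
  - by rewrite /n addn2.
apply: (@finish _ spot (iota 0 n)) => [x||].
- by rewrite mem_iota add0n spot_lt.
- apply: (layered_colorable r_sym r_irr L_uniq L_size _ _ lay).
    exact: spot_inj.
  by move=> x y /code_adj; apply: place_band => //; apply: s_pos; rewrite m1.
- exact: ceil_div_mono (n_le_card m2).
Qed.

Lemma conclusion_two : m = 2 -> conclusion.
Proof.
move=> mE; have m2 : 0 < m <= 2 by rewrite mE.
have nE : n = s 0 + 2 + s 1 by rewrite /n mE.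
have s0 : 0 < s 0 by apply: s_pos; rewrite mE.
have s1 : 3 <= s 1 by apply: s_3; rewrite mE.
have near_spot x y : r x y -> near n (spot x) (spot y).
  move=> rxy; apply: (place_near s0 mE s1 (code_valid x)); first exact: code_adj.
  by apply: contraTneq rxy => /code_inj ->; apply: r_irr.
have [k5|k5] := leqP 5 k.
  have lay : layered (near n) k (iota 0 n) (ceil_div n k).
    apply: (@band_layered (near n) n k true); rewrite ?eqxx ?leqnn ?andbT //; first by lia.
    - by move=> i j; rewrite /near; lia.
    - by rewrite nE; lia.
  apply: (@finish _ spot (iota 0 n)) => [x||].
  - by rewrite mem_iota add0n spot_lt.
  - apply: (layered_colorable r_sym r_irr L_uniq L_size _ near_spot lay).
    exact: spot_inj.
  - exact: ceil_div_mono (n_le_card m2).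
have k4 : k = 4 by lia.
have n6 : 6 <= n by rewrite nE; lia.
have n_even : ~~ odd n.
  by rewrite nE !oddD !s_odd ?mE.
have L4 v : size (L v) = 4 by rewrite L_size.
have codeP : cyclic_code r n spot unspot.
  split=> // [|x|j jn]; last by rewrite spotK.
    exact: spot_inj.
  exact: spot_lt.
have [code' ltn col] := cycle_four_choosable r_sym r_irr L_uniq n6 n_even L4 codeP.
apply: (finish _ col) => [x|]; first by rewrite mem_iota add0n ltn.
by rewrite -k4; apply: ceil_div_mono (n_le_card m2).
Qed.

Lemma ends_rows_le_card : 2 + sumn [seq s i | i <- iota 0 m] <= #|T|.
Proof.
pose rows := [seq (i, p) | i <- iota 0 m, p <- iota 1 (s i)].
have sz : size rows = sumn [seq s i | i <- iota 0 m].
  by rewrite size_allpairs_dep; congr sumn; apply: eq_map => i; rewrite size_iota.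
have rowsP c : c \in rows -> [&& c.1 < m, 0 < c.2 & c.2 <= s c.1].
  by case/allpairsPdep=> i [p [/= + + ->]] /=; rewrite !mem_iota; lia.
have notin q : (m, q) \notin rows by apply/negP => /rowsP /=; rewrite ltnn.
rewrite -sz -[2 + _]/(size [:: (m, 0), (m, 1) & rows]); apply: size_le_card.
  rewrite /= !inE xpair_eqE andbF !(negbTE (notin _)) /= allpairs_uniq_dep ?iota_uniq //.
    by move=> i _; apply: iota_uniq.
  by case=> [i p] [j q] _ _ [-> ->].
by move=> c; rewrite !inE /valid => /or3P[/eqP->|/eqP->|/rowsP->]; rewrite ?eqxx ?orbT.
Qed.

Section Short.
Hypotheses (m3 : 3 <= m) (s_short : forall i, 0 < i < m -> s i = 3) (s_0 : s 0 <= 3).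
Let o : nat := s 0 == 1.

Lemma short_card : 3 * (m - o) + 2 + o <= #|T|.
Proof.
apply: leq_trans ends_rows_le_card.
have -> : sumn [seq s i | i <- iota 0 m] = s 0 + 3 * m.-1.
  have rows q a : (forall i, a <= i < a + q -> s i = 3) -> sumn [seq s i | i <- iota a q] = 3 * q.
    elim: q a => //= q IH a H; rewrite IH => [|i ai]; last by apply: H; lia.
    by rewrite H; lia.
  case: (m) m3 s_short => // m' _ sh /=; rewrite rows // => i im; apply: sh; lia.
have := s_odd (ltac:(lia) : 0 < m); have := s_pos (ltac:(lia) : 0 < m).
by rewrite /o; case: eqP => [->|]; lia.
Qed.

Lemma conclusion_special : s 0 = 1 -> m = 4 -> k = 6 -> conclusion.
Proof.
move=> s01 m4 k6; pose s1 i := if i == 0 then 1 else 3.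
have vE c : valid 4 s1 c = valid m s c.
  rewrite /valid m4; congr orb; apply: andb_id2l => cm; congr andb; congr leq.
  by rewrite /s1; case: eqP => [->|c0] //; rewrite s_short // m4; lia.
have aE x y : cadj m s (code x) (code y) = cadj 4 s1 (code x) (code y).
  rewrite -m4; apply: eq_cadj => // i im.
  by rewrite /s1; case: eqP => [->|i0] //; rewrite s_short //; lia.
pose adj (c d : nat * nat) := cadj 4 s1 c d && (c != d).
pose all_codes := [:: (4, 0); (4, 1); (0, 1); (1, 1); (1, 2); (1, 3); (2, 1); (2, 2); (2, 3);
  (3, 1); (3, 2); (3, 3)].
have in_all x : code x \in all_codes.
  have := code_valid x; rewrite -vE /valid /s1 /all_codes; case: (code x) => a b /=.
  by case: a => [|[|[|[|[|a]]]]] //; case: b => [|[|[|[|b]]]].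
(* [special_matched] needs adjacency in both directions. [r'] is the full adjacency of the model and
   contains [r], so it suffices to colour [r']. *)
pose r' x y := adj (code x) (code y).
have r'_sym : symmetric r'.
  have /allP H : all (fun c => all (fun d => adj c d == adj d c) all_codes) all_codes.
    by vm_compute.
  by move=> x y; apply/eqP; apply: (allP (H _ (in_all x))).
have r'_irr x : ~~ r' x x by rewrite /r' /adj eqxx andbF.
have rr' x y : r x y -> r' x y.
  move=> rxy; rewrite /r' /adj -aE code_adj //=.
  by apply: contraTneq rxy => /code_inj ->; apply: r_irr.
have L6 v : size (L v) = 6 by rewrite L_size.
have r'_adj x y : r' x y -> cadj 4 s1 (code x) (code y) by case/andP.
have adj_r' x y : cadj 4 s1 (code x) (code y) -> code x != code y -> r' x y.
  by rewrite /r' /adj => ->.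
have decK4 c : valid 4 s1 c -> code (dec c) = c by rewrite vE; apply: decK.
have [O vO [f [fL fr fq]]] := special_colorable r'_sym r'_irr L_uniq L6 code_inj r'_adj decK4 adj_r'.
apply: (finish (O := O) (q := 2) (code' := code)) => [x||].
- by apply: vO; rewrite vE.
- by exists f; split=> // x y xO yO /rr'; apply: fr.
- apply: ceil_div_gt; first by lia.
  by apply: leq_trans short_card; rewrite /o s01; lia.
Qed.

Lemma conclusion_short : conclusion.
Proof.
have [|Tk] := leqP #|T| k; first exact: finish_small.
have k0 : 0 < k by lia.
have ceil_ge q : (q * k < #|T|) -> q < ceil_div #|T| k by exact: ceil_div_gt.
have o1 : o <= 1 by rewrite /o; case: eqP.
have so : 0 < o -> s 0 = 1 by rewrite /o; case: eqP.
have sr i : o <= i < m -> s i = 3.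
  case: i => [|i] im; last by apply: s_short; case/andP: im.
  have := s_odd (ltac:(lia) : 0 < m); have := s_pos (ltac:(lia) : 0 < m).
  by move: im; rewrite /o; have [->//|] := eqVneq (s 0) 1; lia.
have card := short_card.
have [large|small] := ltnP (2 * k) (3 * (m - o) + 2 + o).
  have [m4|m4] := leqP 3 (m - o); last by lia.
  have [O [vO _ lay]] := short_three o1 mk so sr m4 large.
  by apply: (finish_layered vO lay); apply: ceil_ge; lia.
have q2 : 2 <= ceil_div #|T| k by apply: ceil_ge; lia.
have [o0|o0] := posnP o.
  by have [||O [vO _ lay]] := short_two_free o1 mk so sr o0; [lia|lia|apply: (finish_layered vO lay)].
have oE : o = 1 by lia.
have [M2|M3] := leqP (m - o) 2.
  by have [|O [vO _ lay]] := short_two_small o1 mk so sr oE; [lia|apply: (finish_layered vO lay)].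
have [kM|kM] := leqP (m - o + 4) k.
  by have [|O [vO _ lay]] := short_two_edge o1 mk so sr oE M3 kM; [lia|apply: (finish_layered vO lay)].
(* Now [k = m - o + 3] with [o = 1], and [3 * (m - o) + 3 <= 2 * k] forces [m - o = 3]: only
   Theta(1, 2, 2, 2) is left. *)
by apply: conclusion_special; [exact: so|lia|lia].
Qed.

End Short.

Lemma conclusion_zero : m = 0 -> conclusion.
Proof.
move=> m0; apply: finish_small; apply: leq_trans (_ : size [:: (0, 0); (0, 1)] <= _); last by rewrite /=; lia.
rewrite cardE -(size_map code); apply: uniq_leq_size; first by rewrite map_inj_uniq ?enum_uniq.
move=> c /mapP[x _ ->]; have := code_valid x; rewrite /valid m0; case: (code x) => [a b] /=.
by rewrite !inE !xpair_eqE; lia.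
Qed.

Theorem model_choosable : conclusion.
Proof.
have [m3|m2] := leqP 3 m; last first.
  case: (ltngtP m 1) => m1; last exact: conclusion_one.
    by apply: conclusion_zero; lia.
  by apply: conclusion_two; lia.
have [s5|s4] := leqP 5 (s m.-1); first exact: conclusion_long.
have s_le3 i : i < m -> s i <= 3.
  by move=> im; have := @s_sorted i m.-1 ltac:(lia); have := s_odd im; lia.
apply: conclusion_short => //; last by apply: s_le3; lia.
by move=> i im; have := s_ge3 im; have := s_le3 i ltac:(lia); lia.
Qed.

End ModelTheorem.

(** * The total graph *)

Section Positions.
Variables (m : nat) (s : nat -> nat).

Lemma pos_inj i j p q : i < m -> j < m -> p <= (s i).+1 -> q <= (s j).+1 ->
  pos m s i p = pos m s j q ->
  [\/ p = 0 /\ q = 0, p = (s i).+1 /\ q = (s j).+1 | i = j /\ p = q].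
Proof.
rewrite /pos => im jm ps qs; case: (p =P 0) => [p0|_].
  case: (q =P 0) => [q0|_]; first by constructor 1.
  by case: ifP => // _ [E]; rewrite E ltnn in jm.
case: (leqP p (s i)) => ps'; case: (q =P 0) => [q0|_] //.
- by case=> E; rewrite E ltnn in im.
- case: (leqP q (s j)) => qs' [E1 E2]; first by constructor 3.
  by rewrite E1 ltnn in im.
case: (leqP q (s j)) => qs' E; first by case: E => E _; rewrite -E ltnn in jm.
by constructor 2; split; apply/eqP; rewrite eqn_leq ?ps ?qs.
Qed.

Lemma pos_valid i p : i < m -> valid m s (pos m s i p).
Proof.
rewrite /pos /valid => im; case: (p =P 0) => [_|p0]; first by rewrite eqxx.
by case: ifP => ps /=; rewrite ?eqxx // im ps lt0n; move/eqP: p0 => ->; rewrite orbT.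
Qed.

Lemma pos_cadj i p q : i < m -> 0 < s i -> p <= (s i).+1 -> q <= (s i).+1 ->
  p != q -> (p - q) + (q - p) <= 2 -> cadj m s (pos m s i p) (pos m s i q).
Proof.
move=> im si ps qs pq d2; have im' : i \in iota 0 m by rewrite mem_iota.
have [p0|p0] := posnP p.
  rewrite {1}/pos p0 /= cadj_source; apply/orP.
  have [->|q1] := eqVneq q 1; [left|right]; first exact: map_f im'.
  by rewrite (_ : q = 2); [apply: map_f im'|lia].
have [ps'|ps'] := leqP p (s i); last first.
  rewrite {1}/pos gtn_eqF // leqNgt ps' /= cadj_sink; apply/orP.
  have [->|q1] := eqVneq q (s i); [left|right]; first exact: (map_f (fun j => pos m s j (s j))).
  by rewrite (_ : q = (s i).-1); [exact: (map_f (fun j => pos m s j (s j).-1))|lia].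
rewrite {1}/pos gtn_eqF // ps' cadj_path //; apply/or3P; constructor 1.
have : [|| q == p.-2, q == p.-1, q == p.+1 | q == p.+2] by lia.
by rewrite !inE => /or4P[]/eqP->; rewrite eqxx ?orbT.
Qed.

Lemma ends_cadj i j : i < m -> j < m ->
  cadj m s (i, 1) (j, 1) /\ cadj m s (i, s i) (j, s j).
Proof.
move=> im jm; have jm' : j \in iota 0 m by rewrite mem_iota.
rewrite !cadj_path // !eqxx !andTb (map_f (fun j => (j, 1)) jm').
by rewrite (map_f (fun j => (j, s j)) jm') !orbT.
Qed.

End Positions.

Section Bridge.
Variables (m : nat) (l : 'I_m -> nat).
Hypothesis hpos : forall i : 'I_m, 0 < l i.
Hypothesis hsorted : forall i j : 'I_m, i <= j -> l i <= l j.
Hypothesis hl2 : forall i : 'I_m, nat_of_ord i = 1 -> 2 <= l i.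
Local Notation V := (theta_vertex l).
Local Notation e := (@theta_adj m l).
Local Notation TV := (total_vertex e).

Definition inner_size (i : nat) : nat :=
  if insub i is Some j then (l j).*2.-1 else 0.
Local Notation s := inner_size.

Lemma inner_sizeE (i : 'I_m) : s i = (l i).*2.-1.
Proof. by rewrite /inner_size valK. Qed.

Lemma inner_sizeS (i : 'I_m) : (s i).+1 = (l i).*2.
Proof. by rewrite inner_sizeE; have := hpos i; lia. Qed.

Definition inner_vertex (i : 'I_m) (j : 'I_(l i).-1) : V :=
  inr (existT (fun i : 'I_m => 'I_(l i).-1 : Type) i j).
Arguments inner_vertex : clear implicits.

Definition path_vertex (i : 'I_m) (a : nat) : V :=
  if a == 0 then inl true
  else if insub a.-1 is Some j then inner_vertex i j else inl false.

Definition vertex_code (v : V) : nat * nat :=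
  match v with
  | inl true => (m, 0)
  | inl false => (m, 1)
  | inr (existT i j) => (nat_of_ord i, (nat_of_ord j).+1.*2)
  end.

Lemma theta_posP i v a : theta_pos i v = Some a -> v = path_vertex i a /\ a <= l i.
Proof.
case: v => [[|] [<-] //|[i' j]] /=.
  rewrite /path_vertex gtn_eqF // insubF //; have := hpos i; lia.
case: eqP => // i'E; subst i'; case=> <-; rewrite /path_vertex /= valK.
by split=> //; have := ltn_ord j; lia.
Qed.

Lemma path_vertexK i a : a <= l i -> theta_pos i (path_vertex i a) = Some a.
Proof.
rewrite /path_vertex => al; case: (a =P 0) => [->|a0] //.
case: insubP => [j aj jE|na] /=; first by rewrite eqxx jE; congr Some; lia.
by congr Some; move: na; lia.
Qed.

Lemma vertex_code_path i a : a <= l i -> vertex_code (path_vertex i a) = pos m s i a.*2.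
Proof.
rewrite /path_vertex /pos => al; case: (a =P 0) => [->|a0] //.
have S := inner_sizeS i; case: insubP => [j aj jE|na] /=.
  by rewrite jE ifN ?ifT; [congr pair|..]; lia.
by rewrite !ifN //; move: na; lia.
Qed.

Lemma theta_adjP x y : reflect
  (exists i a, a < l i /\ ((x, y) = (path_vertex i a, path_vertex i a.+1) \/
    (y, x) = (path_vertex i a, path_vertex i a.+1)))
  (theta_adj x y).
Proof.
apply: (iffP existsP) => [[i]|[i [a [al xy]]]].
  case Ex: (theta_pos i x) => [a|//]; case Ey: (theta_pos i y) => [b|//].
  have [xE al] := theta_posP Ex; have [yE bl] := theta_posP Ey.
  case/orP=> /eqP ab; rewrite -ab in yE xE al bl; exists i.
    by exists a; split=> //; left; rewrite -xE -yE.
  by exists b; split=> //; right; rewrite -xE -yE.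
by exists i; case: xy => [[-> ->]|[-> ->]]; rewrite !path_vertexK ?eqxx ?orbT // ltnW.
Qed.

Lemma vertex_code_inj : injective vertex_code.
Proof.
case=> [[|]|[i j]] [[|]|[i' j']] //=.
case=> /val_inj iE; subst i' => jE; congr (inner_vertex i); apply: val_inj => /=; lia.
Qed.

Definition edge_position (E : edge_type e) (ia : {i : 'I_m & 'I_(l i)}) : bool :=
  let: existT i a := ia in val E == [set path_vertex i a; path_vertex i a.+1].

(** The [a]-th vertex of a path gets position [2a] and the edge after it [2a + 1]. By [total_codeE]
    the default [(m, 0)] is never the code of an edge. *)
Definition total_code (x : TV) : nat * nat :=
  match x with
  | inl v => vertex_code v
  | inr E => if [pick ia | edge_position E ia] is Some (existT i a)
             then (nat_of_ord i, (nat_of_ord a).*2.+1) else (m, 0)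
  end.

Lemma total_codeE E : exists i a, [/\ a < l i,
  val E = [set path_vertex i a; path_vertex i a.+1] & total_code (inr E) = pos m s i a.*2.+1].
Proof.
rewrite /=; case: pickP => [[i a] /eqP EE|none].
  exists i, a; split=> //; rewrite /pos /= ifT //.
  by have := inner_sizeS i; have := ltn_ord a; lia.
have /existsP[x /existsP[y /andP[/theta_adjP[i [a [al xy]]] /eqP EE]]] := valP E.
have := none (existT _ i (Ordinal al)); rewrite /edge_position /= EE.
by case: xy => [[-> ->]|[-> ->]]; rewrite 1?setUC eqxx.
Qed.

Lemma path_length_ge2 (i : 'I_m) : 0 < i -> 2 <= l i.
Proof.
move=> i0; have m1 : 1 < m := leq_ltn_trans i0 (ltn_ord i).
by apply: leq_trans (hl2 (i := Ordinal m1) erefl) (hsorted _).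
Qed.

(** Edges are sets of vertices, so two paths of length 1 would share theirs; [path_length_ge2]
    excludes this. *)
Lemma path_edge_inj (i j : 'I_m) a b : a < l i -> b < l j ->
  [set path_vertex i a; path_vertex i a.+1] = [set path_vertex j b; path_vertex j b.+1] ->
  i = j /\ a = b.
Proof.
move=> al bl E.
have S := inner_sizeS i; have S' := inner_sizeS j.
have pin p q : p <= l i -> q <= l j -> path_vertex i p = path_vertex j q ->
    [\/ p = 0 /\ q = 0, p = l i /\ q = l j | nat_of_ord i = j /\ p = q].
  move=> pl ql /(congr1 vertex_code); rewrite !vertex_code_path // => /pos_inj H.
  have [||||[]|[]|[]] := H => //; try lia; move=> H1 H2.
  - by constructor 1; lia.
  - by constructor 2; lia.
  - by constructor 3; lia.
suff [ij ab] : nat_of_ord i = j /\ a = b by split=> //; apply: val_inj.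
have l2 := @path_length_ge2 i; have l2' := @path_length_ge2 j.
have lij : nat_of_ord i = j -> l i = l j by move/val_inj->.
have Ea := set21 (path_vertex i a) (path_vertex i a.+1).
have Eb := set22 (path_vertex i a) (path_vertex i a.+1).
have al' := ltnW al; have bl' := ltnW bl.
move: Ea Eb; rewrite E !inE => /orP[/eqP/pin A|/eqP/pin A] /orP[/eqP/pin B|/eqP/pin B];
  by case: (A _ _) => // -[A1 A2]; case: (B _ _) => // -[B1 B2]; lia.
Qed.

Lemma total_adj_sym : symmetric (@total_adj V e).
Proof.
have e_sym : symmetric e.
  by move=> x y; apply/theta_adjP/theta_adjP => -[i [a [al xy]]]; exists i, a;
    (split=> //; case: xy; [right|left]).
by move=> [x|A] [y|B] //=; rewrite eq_sym setIC.
Qed.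

Lemma total_adj_irr x : ~~ @total_adj V e x x.
Proof.
case: x => [x|A] /=; last by rewrite eqxx.
apply/existsP => -[i]; case: (theta_pos i x) => // a; lia.
Qed.

Lemma theta_total_code_adj (x y : TV) : total_adj x y ->
  cadj m s (total_code x) (total_code y).
Proof.
have s0 (i : 'I_m) : 0 < s i by have := inner_sizeS i; have := hpos i; lia.
have step (i : 'I_m) p q : p <= (l i).*2 -> q <= (l i).*2 -> p != q -> (p - q) + (q - p) <= 2 ->
    cadj m s (pos m s i p) (pos m s i q).
  by rewrite -inner_sizeS => ? ? ? ?; apply: pos_cadj.
case: x y => [x|A] [y|B].
- case/theta_adjP=> i [a [al [[-> ->]|[-> ->]]]]; rewrite /= !vertex_code_path //; try lia;
  by apply: step; lia.
- have [i [a [al EB ->]]] := total_codeE B; rewrite /= EB !inE => /orP[]/eqP->.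
    by rewrite vertex_code_path ?(ltnW al) //; apply: step; lia.
  by rewrite vertex_code_path //; apply: step; lia.
- have [i [a [al EB ->]]] := total_codeE A; rewrite /= EB !inE => /orP[]/eqP->.
    by rewrite vertex_code_path ?(ltnW al) //; apply: step; lia.
  by rewrite vertex_code_path //; apply: step; lia.
have [i [a [al EA ->]]] := total_codeE A; have [j [b [bl EB ->]]] := total_codeE B.
case/andP=> AB /set0Pn[v]; rewrite EA EB !inE => /andP[vA vB].
have [p [pl pa vp]] : exists p, [/\ p <= l i, (p == a) || (p == a.+1) & v = path_vertex i p].
  by case/orP: vA => /eqP vE; [exists a|exists a.+1]; rewrite eqxx ?orbT // ltnW.
have [q [ql qb vq]] : exists q, [/\ q <= l j, (q == b) || (q == b.+1) & v = path_vertex j q].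
  by case/orP: vB => /eqP vE; [exists b|exists b.+1]; rewrite eqxx ?orbT // ltnW.
have S := inner_sizeS i; have S' := inner_sizeS j.
have := congr1 vertex_code vp; rewrite vq !vertex_code_path // => /pos_inj H.
(* Edges of different paths can meet only in u or w, as first or last positions. Two edges of one
   path that meet in an inner vertex have positions at distance 2. *)
have [||||[p0 q0]|[p1 q1]|[ij pq]] := H => //; try lia.
- have -> : a = 0 by lia.
  have -> : b = 0 by lia.
  by rewrite /pos /= !s0; case: (ends_cadj s (ltn_ord i) (ltn_ord j)).
- have -> : a.*2.+1 = s i by lia.
  have -> : b.*2.+1 = s j by lia.
  by rewrite /pos !leqnn !gtn_eqF ?s0 //; case: (ends_cadj s (ltn_ord i) (ltn_ord j)).
have {ij}ij : i = j by apply: val_inj.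
subst j; apply: step; try lia.
by apply: contraNneq AB => ab; apply/eqP/val_inj; rewrite EA EB (_ : a = b) //; lia.
Qed.

Lemma total_code_valid x : valid m s (total_code x).
Proof.
case: x => [[[|]|[i j]]|E] /=; rewrite -?[if _ is Some _ then _ else _]/(total_code (inr E)).
- by rewrite /valid eqxx.
- by rewrite /valid eqxx.
- have := inner_sizeS i; have := ltn_ord j; have := ltn_ord i; rewrite /valid /=; lia.
- by have [i [a [al _ ->]]] := total_codeE E; apply: pos_valid.
Qed.

Lemma total_code_inj : injective total_code.
Proof.
(* Edges have odd positions and inner vertices even ones; w, coded [(m, 1)], is told apart by its
   first coordinate. *)
have parity v E : vertex_code v != total_code (inr E).
  have [i [a [al _ ->]]] := total_codeE E; have S := inner_sizeS i.
  rewrite /pos /= ifT; last by lia.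
  case: v => [[|]|[i' j]] /=; rewrite xpair_eqE; have := ltn_ord i; lia.
case=> [x|A] [y|B]; [|by move/eqP; rewrite (negbTE (parity _ _))
  |by move/esym/eqP; rewrite (negbTE (parity _ _))|].
  by move=> /vertex_code_inj->.
have [i [a [al EA ->]]] := total_codeE A; have [j [b [bl EB ->]]] := total_codeE B.
have S := inner_sizeS i; have S' := inner_sizeS j.
move=> /pos_inj H; have [||||[]|[]|[ij ab]] := H => //; try lia.
congr inr; apply: val_inj; have {ij}ij : i = j by apply: val_inj.
by subst j; rewrite EA EB (_ : a = b) //; lia.
Qed.

Lemma total_code_surj c : valid m s c -> exists x, total_code x = c.
Proof.
case: c => i0 p0; rewrite {1}/valid /= => /orP[/andP[/eqP-> p1]|/and3P[im p_gt0 ps]].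
  by case: p0 p1 => [|[|//]] _; [exists (inl (inl true))|exists (inl (inl false))].
suff [i [p [pl ->]]] : exists (i : 'I_m) p, p <= (l i).*2 /\ (i0, p0) = pos m s i p.
  have [pE|pE] := boolP (odd p); last first.
    exists (inl (path_vertex i p./2)); rewrite /= vertex_code_path; last by lia.
    by congr pos; lia.
  have al : p./2 < l i by lia.
  have eE : is_edge e [set path_vertex i p./2; path_vertex i p./2.+1].
    apply/existsP; exists (path_vertex i p./2); apply/existsP; exists (path_vertex i p./2.+1).
    by rewrite eqxx andbT; apply/theta_adjP; exists i, p./2; split=> //; left.
  pose E : edge_type e := Sub _ eE.
  exists (inr E); have [j [b [bl EE ->]]] := total_codeE E.
  by move: EE; rewrite SubK => /(path_edge_inj al bl)[<- <-]; congr pos; lia.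
exists (Ordinal im), p0; have := inner_sizeS (Ordinal im); rewrite /= => E; split; first by lia.
by rewrite /pos gtn_eqF // ps.
Qed.

End Bridge.

Theorem theorem1p6 (m : nat) (l : 'I_m -> nat)
    (hpos : forall i : 'I_m, 0 < l i)
    (hsorted : forall i j : 'I_m, i <= j -> l i <= l j)
    (hl2 : forall i : 'I_m, nat_of_ord i = 1 -> 2 <= l i) :
  forall k : nat, m + 2 <= k ->
    equitably_choosable (@total_adj (theta_vertex l) (@theta_adj m l)) k.
Proof.
move=> k mk L HL.
have L_uniq v : uniq (L v) by have [] := HL v.
have L_size v : size (L v) = k by have [] := HL v.
pose code := @total_code m l.
pose dec c := odflt (inl (inl true)) [pick x | code x == c].
have decK c : valid m (inner_size l) c -> code (dec c) = c.
  move=> vc; rewrite /dec; case: pickP => [x /eqP //|none].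
  by have [x xc] := total_code_surj hpos hsorted hl2 vc; have /negP[] := negbT (none x); apply/eqP.
have sE i (im : i < m) : inner_size l i = (l (Ordinal im)).*2.-1 := inner_sizeE l (Ordinal im).
have [||||f fP] := model_choosable (@total_adj_sym m l hpos) (@total_adj_irr m l) L_uniq L_size
  (total_code_inj hpos) (total_code_valid hpos) decK
  (@theta_total_code_adj m l hpos) mk; last by exists f.
- by move=> i im; rewrite sE; have := hpos (Ordinal im); lia.
- by move=> i im; rewrite sE; have := hpos (Ordinal im); lia.
- move=> i j /andP[ij jm]; rewrite !(sE _ (leq_ltn_trans ij jm)) (sE _ jm).
  have := @hsorted (Ordinal (leq_ltn_trans ij jm)) (Ordinal jm) ij; lia.
- by move=> m1; rewrite (sE 1 m1); have := @hl2 (Ordinal m1) erefl; lia.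
Qed.
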